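(* Assuming the Strong Exponential Time Hypothesis (SETH), for no $\alpha>0$ is there an algorithm that, given a homogeneous regular expression $\mathcal{A}$ of type $\circ +$ of size $m$ and a homogeneous regular expression $\mathcal{B}$ of type $\circ |$ of size $n$, decides whether $\mathcal{L}(\mathcal{A})\cap\mathcal{L}(\mathcal{B})\neq\emptyset$ in time $\mathcal{O}((mn)^{1-\alpha})$.
   Context: Regular expressions over an alphabet $\Sigma$ are built from letters with concatenation $\circ$, union $|$, Kleene plus $+$ ($\mathcal{L}(\mathcal{C}^+)$ is the set of concatenations of $k\ge 1$ words of $\mathcal{L}(\mathcal{C})$) and Kleene star $*$ ($\mathcal{L}(\mathcal{C}^* )=\mathcal{L}(\mathcal{C}^+)\cup\{\epsilon\}$). A regular expression is viewed as a rooted tree whose leaves are letters and whose inner nodes are operators ($+,*$ have one child; $\circ,|$ may have several). The size of a regular expression is the number of leaves of its tree. It is homogeneous of type $t_1t_2$ (depth 2), with $t_1\neq t_2\in\{\circ,|,+,*\}$, if its root is labelled $t_1$, every inner node at depth 1 is labelled $t_2$, the children of depth-1 inner nodes are leaves, and the tree has depth 3. Thus a regexp of type $\circ+$ is a concatenation of symbols each of the form $c$ or $c^+$ ($c\in\Sigma$), and a regexp of type $\circ|$ is a concatenation of symbols each being a letter or a union of letters. The Strong Exponential Time Hypothesis states that for every $\epsilon>0$ there is $k$ such that $k$-SAT on $n$ variables cannot be solved in time $\mathcal{O}(2^{(1-\epsilon)n})$. *)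

(* Defs.v *)
From Stdlib Require Import Reals List Arith.
Import ListNotations.

(** * Random-access machines with logarithmic cost

   The registers are addressed directly and the memory indirectly; both hold
   natural numbers of any size.  An instruction costs the bit length of the
   values (addresses included) on which it acts, so that long numbers give no
   free parallelism.  Up to factors polylogarithmic in the running time this is
   the word RAM whose words have logarithmically many bits; such factors are
   absorbed by the epsilon and the alpha of the time bounds below. *)

Inductive instr : Type :=
| IConst (i c : nat)
| IAdd (i j k : nat)
| ISub (i j k : nat)
| ILoad (i j : nat)
| IStore (i j : nat)
| IJumpPos (j l : nat).

Definition program : Type := list instr.

Record config : Type := Config {
  pc : nat;
  reg : nat -> nat;
  mem : nat -> nat
}.

Definition update (f : nat -> nat) (i v : nat) : nat -> nat :=
  fun j => if Nat.eqb j i then v else f j.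

Definition exec (a : instr) (c : config) : config :=
  let r := reg c in
  let set i v := Config (S (pc c)) (update r i v) (mem c) in
  match a with
  | IConst i v => set i v
  | IAdd i j k => set i (r j + r k)
  | ISub i j k => set i (r j - r k)
  | ILoad i j => set i (mem c (r j))
  | IStore i j => Config (S (pc c)) r (update (mem c) (r i) (r j))
  | IJumpPos j l =>
      Config (if Nat.eqb (r j) 0 then S (pc c) else l) r (mem c)
  end.

Definition bitlen (x : nat) : nat := S (Nat.log2 x).

Definition cost (a : instr) (c : config) : nat :=
  let r := reg c in
  match a with
  | IConst _ v => bitlen v
  | IAdd _ j k | ISub _ j k => bitlen (r j) + bitlen (r k)
  | ILoad _ j => bitlen (r j) + bitlen (mem c (r j))
  | IStore i j => bitlen (r i) + bitlen (r j)
  | IJumpPos j _ => bitlen (r j)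
  end.

(** [runs P c t c']: started in [c], the program [P] halts in [c'] after time
    [t].  It halts when the program counter leaves the program. *)
Inductive runs (P : program) : config -> nat -> config -> Prop :=
| runs_halt c : nth_error P (pc c) = None -> runs P c 0 c
| runs_step c a t c' :
    nth_error P (pc c) = Some a ->
    runs P (exec a c) t c' ->
    runs P c (cost a c + t) c'.

(** The input occupies the first memory cells, register 0 holds its length, and
    everything else is 0. *)
Definition initial (input : list nat) : config :=
  Config 0 (update (fun _ => 0) 0 (length input)) (fun i => nth i input 0).

(** Acceptance is a nonzero register 0 on halting. *)
Definition decides_within
    (P : program) (input : list nat) (answer : Prop) (bound : R) : Prop :=
  exists t c, runs P (initial input) t c /\
    (reg c 0 <> 0 <-> answer) /\ (INR t <= bound)%R.

(** * Satisfiability and SETH *)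

(** [(v, true)] is the variable [v] and [(v, false)] its negation. *)
Definition literal : Type := (nat * bool)%type.
Definition clause : Type := list literal.
Definition cnf : Type := list clause.

(** A formula is a set of clauses, whence [NoDup]: with repetitions its length
    would not be bounded in terms of [k] and [n], and no bound depending on [n]
    alone could hold for any algorithm that reads its input. *)
Definition is_kcnf (k n : nat) (F : cnf) : Prop :=
  NoDup F /\
  forall cl, In cl F ->
    length cl <= k /\ forall l, In l cl -> fst l < n.

Definition satisfiable (F : cnf) : Prop :=
  exists val : nat -> bool,
    forall cl, In cl F -> exists l, In l cl /\ val (fst l) = snd l.

Definition encode_literal (l : literal) : nat :=
  2 * fst l + (if snd l then 1 else 0).

Definition encode_clause (cl : clause) : list nat :=
  length cl :: map encode_literal cl.

Definition encode_cnf (n : nat) (F : cnf) : list nat :=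
  n :: length F :: flat_map encode_clause F.

Definition SETH : Prop :=
  forall eps : R, (0 < eps)%R ->
  exists k : nat,
    ~ exists (P : program) (K : R),
        forall (n : nat) (F : cnf), is_kcnf k n F ->
          decides_within P (encode_cnf n F) (satisfiable F)
            (K * Rpower 2 ((1 - eps) * INR n))%R.

(** * Regular expressions *)

Definition word : Type := list nat.
Definition language : Type := word -> Prop.

Definition lang_cat (L1 L2 : language) : language :=
  fun w => exists u v, w = u ++ v /\ L1 u /\ L2 v.

Definition lang_plus (L : language) : language :=
  fun w => exists ws, ws <> [] /\ Forall L ws /\ w = concat ws.

Inductive regexp : Type :=
| Letter (c : nat)
| Conc (rs : list regexp)
| Alt (rs : list regexp)
| Plus (r : regexp)
| Star (r : regexp).

Fixpoint lang (r : regexp) : language :=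
  match r with
  | Letter c => fun w => w = [c]
  | Conc rs => fold_right lang_cat (fun w => w = []) (map lang rs)
  | Alt rs => fun w => Exists (fun L : language => L w) (map lang rs)
  | Plus r => lang_plus (lang r)
  | Star r => fun w => lang_plus (lang r) w \/ w = []
  end.

Fixpoint size (r : regexp) : nat :=
  match r with
  | Letter _ => 1
  | Conc rs | Alt rs => list_sum (map size rs)
  | Plus r | Star r => size r
  end.

Inductive op : Type := OpConc | OpAlt | OpPlus | OpStar.

(** [None] for the leaves. *)
Definition label (r : regexp) : option op :=
  match r with
  | Letter _ => None
  | Conc _ => Some OpConc
  | Alt _ => Some OpAlt
  | Plus _ => Some OpPlus
  | Star _ => Some OpStar
  end.

Definition children (r : regexp) : list regexp :=
  match r with
  | Letter _ => []
  | Conc rs | Alt rs => rs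
  | Plus r | Star r => [r]
  end.

(** Number of levels of the tree: a single leaf has 1. *)
Fixpoint levels (r : regexp) : nat :=
  match r with
  | Letter _ => 1
  | Conc rs | Alt rs => S (list_max (map levels rs))
  | Plus r | Star r => S (levels r)
  end.

(** The requirement [children s <> []] excludes childless [Conc] and [Alt]
    nodes, which would be leaves that are not letters; for the root it follows
    from the number of levels. *)
Definition homogeneous (t1 t2 : op) (r : regexp) : Prop :=
  t1 <> t2 /\
  label r = Some t1 /\
  (forall s, In s (children r) -> label s <> None ->
     label s = Some t2 /\ children s <> [] /\
     forall l, In l (children s) -> label l = None) /\
  levels r = 3.

Fixpoint letters (r : regexp) : list nat :=
  match r with
  | Letter c => [c]
  | Conc rs | Alt rs => flat_map letters rs
  | Plus r | Star r => letters r
  end.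

Definition over_alphabet (sigma : nat) (r : regexp) : Prop :=
  Forall (fun c => c < sigma) (letters r).

(** Preorder traversal of the tree with arities; it is self-delimiting. *)
Fixpoint encode_regexp (r : regexp) : list nat :=
  match r with
  | Letter c => [0; c]
  | Conc rs => 1 :: length rs :: flat_map encode_regexp rs
  | Alt rs => 2 :: length rs :: flat_map encode_regexp rs
  | Plus r => 3 :: 1 :: encode_regexp r
  | Star r => 4 :: 1 :: encode_regexp r
  end.

(** [P] decides, for [A] of type [t1 t2] and [B] of type [u1 u2], whether the
    languages of [A] and [B] meet, in time at most [bound (size A) (size B)].
    At most [size A + size B] letters occur in [A] and [B], so they are numbered
    below this sum; with arbitrarily long names for the letters, reading a single
    one could exceed any bound in terms of the sizes. *)
Definition decides_intersection (t1 t2 u1 u2 : op)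
    (P : program) (bound : nat -> nat -> R) : Prop :=
  forall A B : regexp,
    homogeneous t1 t2 A -> homogeneous u1 u2 B ->
    over_alphabet (size A + size B) A -> over_alphabet (size A + size B) B ->
    decides_within P (encode_regexp A ++ encode_regexp B)
      (exists w : word, lang A w /\ lang B w)
      (bound (size A) (size B)).

(* Main.v *)
Require Import Defs.
From Stdlib Require Import Reals List Arith Lia Lra Bool FunctionalExtensionality.
Import ListNotations.

(** Split the variables into two halves of [H = ceil (n / 2)] variables, with
    [N = 2 ^ H] assignments each. A half assignment is the 0/1 vector of the
    clauses that it leaves unsatisfied, and a formula is satisfiable if and only
    if some vector [u] of the first half and some [v] of the second have no common
    1. With [s] the marker, [x] and [y] the two stay letters and [U] the union of
    all letters, take for [A] the concatenation over all [u] of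
    [x+ s u_1 ... u_d y+], and for [B] the expression [U^L x W y U^L], where [W]
    is the concatenation over all [v] of [(s|x|y) (0|1-v_1|x|y) ... (0|1-v_d|x|y)]
    and [L = |A|]. A common word has a letter of an [x]-run of [A] on the [x] of
    [B] and a letter of a [y]-run on the [y], so that it passes some [s u] inside
    [W], where the marker aligns it with some [v]. Conversely, [x] and [y] may
    stay on [W] before and after the block of [v], and the other blocks of [A] fit
    into the two [U^L].

    Both expressions have size [N] up to factors polynomial in [n] for fixed [k],
    and so does the time to write them. An intersection test in time
    [(|A| |B|) ^ (1 - alpha)] thus decides k-SAT in time
    [2 ^ ((1 - alpha) n)] up to such factors, for every [k]. *)

(** * The regular expressions *)

(** All words of [regB] have one and the same length, whereas the runs of [regA] stretch. The
    shortest words of [regA] have length [|A|], so that [U^L] with [L = |A|] has room for all blocks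
    on one side of the chosen one, and stretching a run reaches the length [L] exactly. The price is
    linear in [|A|]: both expressions keep a size of about [2 ^ (n / 2)], and the product of the
    sizes is about [2 ^ n]. The vectors have one entry per clause, and formulas without repeated
    clauses have at most [(2 n + 1) ^ k] of them.

    The other obstacle is the machine. The intersection test is a given program that expects to be
    started in [initial]: its input from address 0 on, every other cell and register 0. The
    reduction must therefore move its own input out of the way, write the expressions in its place
    and remove its traces. It has neither multiplication nor halving, and every value that it
    touches must stay short, since instructions are charged by bit length. *)

Definition stay_left : nat := 3.
Definition stay_right : nat := 4.
Definition marker : nat := 2.

Definition alt (S : list nat) : regexp := Alt (map Letter S).

Definition ablock (u : list nat) : list regexp :=
  [Plus (Letter stay_left); Letter marker] ++ map Letter u
    ++ [Plus (Letter stay_right)].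

(** For [x = 1] the letter [1 - x] repeats 0, so that among the bits only 0 may face a 1; for
    [x = 0] both bits may. The repetition keeps the arity at four whatever the bit, so that the
    program emits one fixed pattern around [1 - x]. *)
Definition choices (x : nat) : list nat := [0; 1 - x; stay_left; stay_right].

Definition bblock (u : list nat) : list (list nat) :=
  [marker; stay_left; stay_right]
    :: map choices u.

Definition universal (L : nat) : list regexp :=
  repeat (alt [0; 1; marker; stay_left; stay_right]) L.

Definition regA (us : list (list nat)) : regexp := Conc (flat_map ablock us).

Definition regB (L : nat) (us : list (list nat)) : regexp :=
  Conc (universal L ++ [Letter stay_left] ++ map alt (flat_map bblock us)
          ++ [Letter stay_right] ++ universal L).

Definition compatible (u v : list nat) : Prop :=
  Forall2 (fun x y => x = 0 \/ y = 0) u v.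

Lemma lang_conc_nil w : lang (Conc []) w <-> w = [].
Proof. reflexivity. Qed.

Lemma lang_conc_cons r rs w :
  lang (Conc (r :: rs)) w <->
  exists u v, w = u ++ v /\ lang r u /\ lang (Conc rs) v.
Proof. reflexivity. Qed.

Lemma lang_conc_app rs1 rs2 w :
  lang (Conc (rs1 ++ rs2)) w <->
  exists u v, w = u ++ v /\ lang (Conc rs1) u /\ lang (Conc rs2) v.
Proof.
  revert w; induction rs1 as [|r rs1 IH]; intros w.
  - split.
    + intros H; exists [], w; repeat split; auto.
    + intros (u & v & -> & Hu & Hv). apply (proj1 (lang_conc_nil _)) in Hu; subst; exact Hv.
  - simpl app. rewrite lang_conc_cons. split.
    + intros (u & v & -> & Hu & Hv). apply IH in Hv.
      destruct Hv as (v1 & v2 & -> & H1 & H2).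
      exists (u ++ v1), v2; rewrite app_assoc; repeat split; auto.
      apply lang_conc_cons; eauto.
    + intros (u & v & -> & Hu & Hv). apply lang_conc_cons in Hu.
      destruct Hu as (u1 & u2 & -> & H1 & H2).
      exists u1, (u2 ++ v); rewrite app_assoc; repeat split; auto.
      apply IH; eauto.
Qed.

Lemma lang_letters u w : lang (Conc (map Letter u)) w <-> w = u.
Proof.
  revert w; induction u as [|c u IH]; intros w.
  - apply lang_conc_nil.
  - simpl map. rewrite lang_conc_cons. split.
    + intros (x & y & -> & Hx & Hy). apply IH in Hy. simpl in Hx; subst; auto.
    + intros ->. exists [c], u; repeat split; apply IH; auto.
Qed.

Lemma lang_alt S w : lang (alt S) w <-> exists c, w = [c] /\ In c S.
Proof.
  unfold alt; simpl. rewrite Exists_exists. split.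
  - intros (L & HL & Hw). rewrite map_map in HL. apply in_map_iff in HL.
    destruct HL as (c & <- & Hc). simpl in Hw; eauto.
  - intros (c & -> & Hc). exists (fun w => w = [c]); split; auto.
    rewrite map_map. apply in_map_iff. exists c; auto.
Qed.

Lemma lang_alts Ss w :
  lang (Conc (map alt Ss)) w <-> Forall2 (fun c S => In c S) w Ss.
Proof.
  revert w; induction Ss as [|S Ss IH]; intros w; simpl map.
  - rewrite lang_conc_nil. split; [intros ->; auto | inversion 1; auto].
  - rewrite lang_conc_cons. split.
    + intros (x & y & -> & Hx & Hy). apply lang_alt in Hx.
      destruct Hx as (c & -> & Hc). constructor; auto. apply IH; auto.
    + intros H; inversion H as [|c ? w' ? Hc Hw]; subst.
      exists [c], w'; repeat split; [apply lang_alt; eauto | apply IH; auto].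
Qed.

Lemma lang_plus_letter c w :
  lang (Plus (Letter c)) w <-> exists p, w = repeat c (S p).
Proof.
  simpl. unfold lang_plus. split.
  - intros (ws & Hne & Hall & ->). destruct ws as [|w0 ws]; [easy|].
    exists (length ws). clear Hne. revert w0 Hall.
    induction ws as [|w1 ws IH]; intros w0 Hall; inversion Hall; subst; auto.
    simpl in *. f_equal. apply IH; auto.
  - intros (p & ->). exists (repeat [c] (S p)); repeat split; try easy.
    + apply Forall_forall. intros x Hx. apply repeat_spec in Hx; auto.
    + induction p as [|p IH]; auto. simpl in *. f_equal. auto.
Qed.

Lemma lang_ablock u w :
  lang (Conc (ablock u)) w <->
  exists p q,
    w = repeat stay_left (S p) ++ marker :: u ++ repeat stay_right (S q).
Proof.
  unfold ablock. simpl app. rewrite lang_conc_cons. split.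
  - intros (x & y & -> & Hx & Hy). apply lang_plus_letter in Hx.
    destruct Hx as (p & ->). exists p.
    apply lang_conc_cons in Hy. destruct Hy as (y1 & y2 & -> & Hy1 & Hy).
    simpl in Hy1; subst y1. apply lang_conc_app in Hy.
    destruct Hy as (y3 & y4 & -> & Hy3 & Hy). apply lang_letters in Hy3; subst.
    apply lang_conc_cons in Hy. destruct Hy as (y5 & y6 & -> & Hy5 & Hy).
    apply lang_plus_letter in Hy5. destruct Hy5 as (q & ->).
    apply (proj1 (lang_conc_nil _)) in Hy; subst. exists q. rewrite app_nil_r; auto.
  - intros (p & q & ->).
    exists (repeat stay_left (S p)), (marker :: u ++ repeat stay_right (S q)).
    split; [reflexivity|]; split; [apply lang_plus_letter; eauto|].
    apply lang_conc_cons. exists [marker], (u ++ repeat stay_right (S q)).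
    repeat split. apply lang_conc_app.
    exists u, (repeat stay_right (S q)).
    split; [reflexivity|]; split; [apply lang_letters; auto|].
    apply lang_conc_cons. exists (repeat stay_right (S q)), [].
    rewrite app_nil_r; repeat split. apply lang_plus_letter; eauto.
Qed.

Lemma regA_cons u us w :
  lang (regA (u :: us)) w <->
  exists p q w',
    w = repeat stay_left (S p) ++ marker :: u ++ repeat stay_right (S q) ++ w'
    /\ lang (regA us) w'.
Proof.
  unfold regA. change (flat_map ablock (u :: us))
    with (ablock u ++ flat_map ablock us).
  rewrite lang_conc_app. split.
  - intros (x & y & -> & Hx & Hy). apply lang_ablock in Hx.
    destruct Hx as (p & q & ->). exists p, q, y; split; auto.
    rewrite <- !app_assoc; simpl; rewrite <- !app_assoc; auto.
  - intros (p & q & y & -> & Hy).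
    exists (repeat stay_left (S p) ++ marker :: u ++ repeat stay_right (S q)), y.
    repeat split; auto.
    + rewrite <- !app_assoc; simpl; rewrite <- !app_assoc; auto.
    + apply lang_ablock; eauto.
Qed.

(** * A common word yields a compatible pair *)

Definition binary (u : list nat) : Prop := Forall (fun x => x < 2) u.

(** Serves to skip a stretch of a word that is free of a given letter: a vector with its closing run
    for [stay_left], the inside of a block of [regB] for [marker]. *)
Lemma app_inv_occurrence (c : nat) (l1 l2 m1 m2 : list nat) :
  l1 ++ l2 = m1 ++ c :: m2 -> ~ In c l1 ->
  exists m, m1 = l1 ++ m /\ l2 = m ++ c :: m2.
Proof.
  revert m1; induction l1 as [|a l1 IH]; intros m1 E Hn.
  - exists m1; auto.
  - destruct m1 as [|b m1]; simpl in E; injection E as -> E.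
    + exfalso; apply Hn; left; auto.
    + destruct (IH m1 E) as (m & -> & ->); [intros H; apply Hn; right; auto|].
      exists m; auto.
Qed.

(** As the vectors are binary, [stay_left] occurs only in the runs that open the blocks, and such a
    run leads to the marker, the vector and at least one [stay_right]. *)
Lemma run_of_left us : forall w1 w2,
  Forall binary us ->
  lang (regA us) (w1 ++ stay_left :: w2) ->
  exists u p w3, In u us /\ w2 = repeat stay_left p ++ marker :: u ++ stay_right :: w3.
Proof.
  induction us as [|u us IH]; intros w1 w2 Hb H.
  - apply (proj1 (lang_conc_nil _)) in H. destruct w1; discriminate.
  - apply regA_cons in H. destruct H as (p & q & w' & E & Hw').
    inversion Hb as [|? ? Hu Hus]; subst.
    (* Either the chosen letter lies in the opening run of [u], or it comes after that run. *)
    assert (Hcase : (exists p', w2 = repeat stay_left p' ++ marker :: u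
                        ++ repeat stay_right (S q) ++ w')
               \/ (exists m, marker :: u ++ repeat stay_right (S q) ++ w'
                             = m ++ stay_left :: w2)).
    { remember (S p) as p' eqn:Ep; clear Ep. clear Hw' IH. revert p' E.
      induction w1 as [|c w1 IHw]; intros p' E.
      - destruct p' as [|p']; simpl in E; [discriminate|].
        injection E as ->. eauto.
      - destruct p' as [|p']; simpl in E.
        + right. exists (c :: w1). symmetry; exact E.
        + injection E as -> E. eapply IHw; eauto. }
    destruct Hcase as [(p' & ->) | (m & Em)].
    + exists u, p', (repeat stay_right q ++ w'). split; [left; auto|].
      reflexivity.
    (* The rest of the block of [u] has no [stay_left], so the letter lies in a later block. *)
    + assert (Hm : exists m', w' = m' ++ stay_left :: w2).
      { change (marker :: u ++ repeat stay_right (S q) ++ w')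
          with ((marker :: u) ++ repeat stay_right (S q) ++ w') in Em.
        rewrite app_assoc in Em.
        apply app_inv_occurrence in Em.
        - destruct Em as (m' & _ & ->). eauto.
        - rewrite in_app_iff. intros [[Hc|Hc]|Hc].
          + discriminate.
          + unfold binary in Hu. rewrite Forall_forall in Hu.
            apply Hu in Hc. unfold stay_left in Hc; lia.
          + apply repeat_spec in Hc. discriminate. }
      destruct Hm as (m' & ->).
      destruct (IH m' w2 Hus Hw') as (u' & p' & w3 & Hin & ->).
      exists u', p', w3; split; [right|]; auto.
Qed.

Lemma compatible_of_match u v :
  binary u ->
  Forall2 (fun c S => In c S) u
    (map choices v) ->
  binary v -> compatible u v.
Proof.
  revert v; induction u as [|c u IH]; intros [|x v] Hu H Hv; cbn [map] in H;
    inversion H; subst; constructor.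
  - inversion Hu; inversion Hv; subst.
    match goal with H : In c _ |- _ =>
      unfold choices, stay_left, stay_right in H; cbn [In] in H end. lia.
  - inversion Hu; inversion Hv; subst. apply IH; auto.
Qed.

(** Induction on the blocks of [regB], with [p] the length of the run still ahead of the marker. If
    [p = 0], the marker stands on the first symbol of a block, and since [u] and [v] have the same
    length, [u] is read against the choices of [v]. Otherwise the first symbol takes a [stay_left];
    the other symbols admit no marker, so that the whole block lies in the run. The blocks cannot
    run out, because the letter behind them is [stay_right]. *)
Lemma marker_aligned d vs : forall p u wb w3 w2,
  Forall (fun v => length v = d /\ binary v) vs ->
  length u = d -> binary u ->
  Forall2 (fun c S => In c S) wb (flat_map bblock vs) ->
  repeat stay_left p ++ marker :: u ++ w3 = wb ++ stay_right :: w2 ->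
  exists v, In v vs /\ compatible u v.
Proof.
  induction vs as [|v vs IH]; intros p u wb w3 w2 Hvs Hlu Hu Hwb E.
  - simpl in Hwb. inversion Hwb; subst. destruct p; discriminate.
  - apply Forall_cons_iff in Hvs; destruct Hvs as [[Hlv Hv] Hvs'].
    simpl in Hwb. inversion Hwb as [|c0 ? wb' ? Hc0 Hwb']; subst.
    apply Forall2_app_inv_r in Hwb'.
    destruct Hwb' as (cs & wb1 & Hcs & Hwb1 & ->).
    assert (Hlc : length cs = length u).
    { apply Forall2_length in Hcs. rewrite length_map in Hcs. lia. }
    destruct p as [|p]; simpl in E; injection E as <- E.
    + exists v; split; [left; auto|]. rewrite <- app_assoc in E.
      (* The first [length u] letters of the two sides are [u] and [cs]. *)
      apply (f_equal (firstn (length u))) in E.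
      rewrite firstn_app, Nat.sub_diag, firstn_all in E.
      rewrite firstn_app, <- Hlc, Nat.sub_diag, firstn_all in E.
      simpl in E. rewrite !app_nil_r in E. subst cs.
      apply compatible_of_match; auto.
    + rewrite <- app_assoc in E.
      assert (Hn : ~ In marker cs).
      { clear - Hcs Hv. intros Hin.
        remember (map _ v) as Ss eqn:ES. revert v Hv ES.
        induction Hcs as [|c S cs Ss HcS _ IH]; intros v Hv ES; auto.
        destruct v as [|x v]; [discriminate|].
        injection ES as -> ->. inversion Hv; subst.
        destruct Hin as [->|Hin]; [|eapply IH; eauto].
        unfold choices, marker, stay_left, stay_right in HcS. cbn [In] in HcS. lia. }
      symmetry in E. destruct (app_inv_occurrence _ _ _ _ _ E Hn) as (m & Em & E2).
      assert (Hm : exists p', m = repeat stay_left p').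
      { exists (length m). clear - Em.
        assert (H : Forall (eq stay_left) (repeat stay_left p)).
        { apply Forall_forall. intros x Hx. apply repeat_spec in Hx; auto. }
        rewrite Em in H. apply Forall_app in H.
        destruct H as [_ H]. apply Forall_eq_repeat; auto. }
      destruct Hm as (p' & ->). symmetry in E2.
      destruct (IH p' u wb1 w3 w2) as (v' & Hin & Hc); auto.
      exists v'; split; [right|]; auto.
Qed.

Lemma intersection_sound d L us vs w :
  Forall (fun u => length u = d /\ binary u) us ->
  Forall (fun v => length v = d /\ binary v) vs ->
  lang (regA us) w -> lang (regB L vs) w ->
  exists u v, In u us /\ In v vs /\ compatible u v.
Proof.
  intros Hus Hvs HA HB. unfold regB in HB.
  apply lang_conc_app in HB. destruct HB as (w1 & w2 & -> & _ & HB).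
  apply lang_conc_app in HB. destruct HB as (x & w3 & -> & Hx & HB).
  apply lang_conc_app in HB. destruct HB as (wb & w4 & -> & Hwb & HB).
  apply lang_conc_app in HB. destruct HB as (y & w5 & -> & Hy & _).
  apply (lang_letters [stay_left]) in Hx. apply (lang_letters [stay_right]) in Hy.
  subst x y. apply lang_alts in Hwb. simpl in HA.
  apply run_of_left in HA.
  - destruct HA as (u & p & w6 & Hu & E).
    pose proof (proj1 (Forall_forall _ _) Hus u Hu) as [Hl Hb].
    symmetry in E.
    destruct (marker_aligned d vs p u wb (stay_right :: w6) w5) as (v & Hv & Hc); eauto.
  - eapply Forall_impl; [|exact Hus]. intros a [_ H]; exact H.
Qed.

(** * A compatible pair yields a common word *)

Definition in_range (w : list nat) : Prop := Forall (fun c => c < 5) w.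

Lemma lang_universal w : in_range w -> lang (Conc (universal (length w))) w.
Proof.
  intros H. unfold universal.
  change (repeat (alt [0; 1; marker; stay_left; stay_right]) (length w))
    with (repeat (alt [0; 1; 2; 3; 4]) (length w)).
  induction H as [|c w Hc Hw IH]; [reflexivity|].
  simpl repeat. apply lang_conc_cons. exists [c], w; repeat split; auto.
  apply lang_alt. exists c; split; auto. simpl; lia.
Qed.

Lemma in_range_repeat c p : c < 5 -> in_range (repeat c p).
Proof.
  intros H. apply Forall_forall. intros x Hx. apply repeat_spec in Hx; lia.
Qed.

Lemma in_range_binary u : binary u -> in_range u.
Proof. intros H; eapply Forall_impl; [|exact H]. simpl; lia. Qed.

(** A block has shortest word of length [d + 3]; the opening run of the last block takes up the
    excess. *)
Lemma regA_word_of_length d us l :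
  Forall (fun u => length u = d /\ binary u) us ->
  us <> [] -> length us * (d + 3) <= l ->
  exists w, length w = l /\ in_range w /\ lang (regA us) w.
Proof.
  revert l; induction us as [|u us IH]; intros l Hus Hne Hl; [easy|]; clear Hne.
  apply Forall_cons_iff in Hus; destruct Hus as [[Hlu Hu] Hus'].
  simpl in Hl.
  assert (Hw : exists p w, p + (d + 3) + length w = l /\ in_range w
                         /\ lang (regA us) w).
  { destruct us as [|u' us].
    - exists (l - (d + 3)), []. simpl in *. repeat split; try lia. constructor.
    - destruct (IH (l - (d + 3))) as (w & Hw1 & Hw2 & Hw3); auto; try easy; try lia.
      exists 0, w; repeat split; auto; lia. }
  destruct Hw as (p & w & Hw1 & Hw2 & Hw3).
  exists (repeat stay_left (S p) ++ marker :: u ++ repeat stay_right 1 ++ w).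
  repeat split.
  - rewrite length_app, repeat_length; simpl length.
    rewrite length_app; simpl length. lia.
  - unfold in_range. apply Forall_app; split; [apply in_range_repeat; unfold stay_left; lia|].
    constructor; [unfold marker; lia|]. apply Forall_app; split;
      [apply in_range_binary; auto|].
    simpl. constructor; [unfold stay_right; lia | auto].
  - apply regA_cons. exists p, 0, w; auto.
Qed.

Lemma match_of_compatible u v :
  binary u -> binary v -> compatible u v ->
  Forall2 (fun c S => In c S) u
    (map choices v).
Proof.
  intros Hu Hv H; revert Hu Hv; induction H as [|x y u v Hxy _ IH];
    intros Hu Hv; simpl; constructor; inversion Hu; inversion Hv; subst; auto.
  unfold choices; cbn [In]. lia.
Qed.

Lemma stay_in_blocks c vs :
  c = stay_left \/ c = stay_right ->
  Forall2 (fun c S => In c S) (repeat c (length (flat_map bblock vs)))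
    (flat_map bblock vs).
Proof.
  intros Hc.
  assert (H : Forall (In c) (flat_map bblock vs)).
  { apply Forall_flat_map. apply Forall_forall. intros v _. unfold bblock.
    constructor.
    - destruct Hc; subst; simpl; auto.
    - apply Forall_map. apply Forall_forall. intros x _.
      destruct Hc; subst; simpl; auto. }
  induction H; simpl; constructor; auto.
Qed.

Lemma intersection_complete d L us vs u v :
  Forall (fun u => length u = d /\ binary u) us ->
  Forall (fun v => length v = d /\ binary v) vs ->
  length us * (d + 3) <= L ->
  In u us -> In v vs -> compatible u v ->
  exists w, lang (regA us) w /\ lang (regB L vs) w.
Proof.
  intros Hus Hvs HL Hu Hv Huv.
  apply in_split in Hu. destruct Hu as (us1 & us2 & ->).
  apply in_split in Hv. destruct Hv as (vs1 & vs2 & ->).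
  apply Forall_app in Hus. destruct Hus as [Hus1 Hus].
  apply Forall_cons_iff in Hus; destruct Hus as [[Hlu Hbu] Hus2].
  apply Forall_app in Hvs. destruct Hvs as [_ Hvs].
  apply Forall_cons_iff in Hvs; destruct Hvs as [[Hlv Hbv] _].
  rewrite length_app in HL; simpl in HL.
  (* With no block before [u], the [L] letters for the left [U^L] prolong the opening run of [u];
     otherwise they form a word of the earlier blocks. *)
  assert (Hleft : exists wl, length wl = L /\ in_range wl /\
    forall p w, lang (regA (u :: us2)) (repeat stay_left (S p) ++ w) ->
      lang (regA (us1 ++ u :: us2)) (wl ++ repeat stay_left (S p) ++ w)).
  { destruct us1 as [|u1 us1].
    - exists (repeat stay_left L). repeat split.
      + apply repeat_length.
      + apply in_range_repeat; unfold stay_left; lia.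
      + change ([] ++ u :: us2) with (u :: us2). intros p w H. apply regA_cons in H.
        destruct H as (p' & q & w' & E & H). rewrite E.
        apply regA_cons. exists (L + p'), q, w'; split; auto.
        rewrite app_assoc, <- repeat_app. f_equal. f_equal. lia.
    - destruct (regA_word_of_length d (u1 :: us1) L) as (wl & H1 & H2 & H3);
        auto; [easy| nia |].
      exists wl; repeat split; auto. intros p w H. unfold regA.
      rewrite flat_map_app. apply lang_conc_app.
      exists wl, (repeat stay_left (S p) ++ w); auto. }
  (* Symmetric, but the closing run of [u] gets its final length only here: with no later block it
     absorbs the [L] letters, as [q' = q + L]. *)
  assert (Hright : exists wr, length wr = L /\ in_range wr /\
    forall q, exists q' w', lang (regA us2) w' /\
       repeat stay_right (S q') ++ w' = repeat stay_right (S q) ++ wr).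
  { destruct us2 as [|u2 us2].
    - exists (repeat stay_right L). repeat split.
      + apply repeat_length.
      + apply in_range_repeat; unfold stay_right; lia.
      + intros q. exists (q + L), []. split; [reflexivity|].
        rewrite app_nil_r, <- repeat_app. f_equal.
    - destruct (regA_word_of_length d (u2 :: us2) L) as (wr & H1 & H2 & H3);
        auto; [easy| nia |].
      exists wr; repeat split; auto. intros q. exists q, wr. auto. }
  destruct Hleft as (wl & Hl1 & Hl2 & Hl3).
  destruct Hright as (wr & Hr1 & Hr2 & Hr3).
  (* The runs around [u] cover the blocks of [regB] before and after that of [v]. The one further
     letter in [S p] and in [S q] falls on the fixed letter [stay_left] or [stay_right] of
     [regB]. *)
  set (p := length (flat_map bblock vs1)).
  set (q := length (flat_map bblock vs2)).
  exists (wl ++ repeat stay_left (S p) ++ marker :: u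
            ++ repeat stay_right (S q) ++ wr).
  split.
  - apply Hl3. destruct (Hr3 q) as (q' & w' & Hw' & E). apply regA_cons.
    exists p, q', w'. rewrite E. auto.
  - unfold regB. apply lang_conc_app. exists wl; eexists; split; [reflexivity|]; split.
    { rewrite <- Hl1. apply lang_universal; auto. }
    apply lang_conc_app. exists [stay_left].
    exists ((repeat stay_left p ++ (marker :: u) ++ repeat stay_right q)
              ++ stay_right :: wr).
    repeat split.
    { replace (repeat stay_right (S q) ++ wr)
        with (repeat stay_right q ++ stay_right :: wr).
      - rewrite <- !app_assoc. reflexivity.
      - change (repeat stay_right (S q)) with (stay_right :: repeat stay_right q).
        rewrite repeat_cons, <- app_assoc. reflexivity. }
    { apply (lang_letters [stay_left]); auto. }
    apply lang_conc_app. do 2 eexists; split; [reflexivity|]; split.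
    { apply lang_alts. rewrite flat_map_app. apply Forall2_app.
      - apply stay_in_blocks; auto.
      - simpl flat_map. change (marker :: u ++ repeat stay_right q)
          with ((marker :: u) ++ repeat stay_right q).
        rewrite app_comm_cons. apply Forall2_app.
        + constructor; [simpl; auto|]. apply match_of_compatible; auto.
        + apply stay_in_blocks; auto. }
    apply lang_conc_cons. exists [stay_right], wr; repeat split.
    rewrite <- Hr1. apply lang_universal; auto.
Qed.

(** * Shape, size and alphabet of the two expressions *)

Lemma list_max_eq l m : Forall (fun x => x <= m) l -> In m l -> list_max l = m.
Proof.
  intros H1 H2. apply Nat.le_antisymm.
  - apply list_max_le; auto.
  - destruct (list_max_le l (list_max l)) as [H _].
    specialize (H (le_n _)). rewrite Forall_forall in H; auto.
Qed.

Lemma in_regA_children us r :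
  In r (flat_map ablock us) ->
  (exists c, r = Letter c) \/ (exists c, r = Plus (Letter c)).
Proof.
  intros H. apply in_flat_map in H. destruct H as (u & _ & H).
  unfold ablock in H. rewrite !in_app_iff, in_map_iff in H. simpl in H.
  destruct H as [[<-|[<-|[]]]|[(c & <- & _)|[<-|[]]]]; eauto.
Qed.

Lemma homogeneous_regA us : us <> [] -> homogeneous OpConc OpPlus (regA us).
Proof.
  intros Hne. repeat split; try discriminate.
  - apply in_regA_children in H. destruct H as [(c & ->)|(c & ->)]; easy.
  - apply in_regA_children in H. destruct H as [(c & ->)|(c & ->)]; easy.
  - apply in_regA_children in H. destruct H as [(c & ->)|(c & ->)];
      intros l Hl; [easy|]. destruct Hl as [<-|[]]; auto.
  - unfold regA. cbn [levels]. f_equal. apply list_max_eq.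
    + apply Forall_map, Forall_forall. intros r Hr.
      apply in_regA_children in Hr. destruct Hr as [(c & ->)|(c & ->)]; simpl; lia.
    + destruct us as [|u us]; [easy|]. left; reflexivity.
Qed.

Definition children_of_regB (L : nat) (us : list (list nat)) : list regexp :=
  universal L ++ [Letter stay_left] ++ map alt (flat_map bblock us)
    ++ [Letter stay_right] ++ universal L.

Lemma in_regB_children L us r :
  In r (children_of_regB L us) ->
  (exists c, r = Letter c /\ c < 5) \/
  (exists S, r = alt S /\ S <> [] /\ Forall (fun c => c < 5) S).
Proof.
  unfold children_of_regB, universal, marker, stay_left, stay_right.
  rewrite !in_app_iff. simpl In.
  assert (HU : In r (repeat (alt [0; 1; 2; 3; 4]) L) ->
    exists S, r = alt S /\ S <> [] /\ Forall (fun c => c < 5) S).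
  { intros H; apply repeat_spec in H. exists [0; 1; 2; 3; 4].
    repeat split; auto; try easy. repeat constructor. }
  intros [H|[[H|[]]|[H|[[H|[]]|H]]]]; auto.
  - left; exists 3; split; auto; lia.
  - right. apply in_map_iff in H. destruct H as (S & <- & H).
    apply in_flat_map in H. destruct H as (u & _ & H). exists S; split; auto.
    destruct H as [<-|H].
    + split; [easy|]. repeat constructor.
    + apply in_map_iff in H. destruct H as (x & <- & _).
      split; [easy|]. unfold choices, stay_left, stay_right.
      repeat (apply Forall_cons; [lia|]); apply Forall_nil.
  - left; exists 4; split; auto; lia.
Qed.

Lemma list_max_letters S : S <> [] -> list_max (map levels (map Letter S)) = 1.
Proof.
  intros H. apply list_max_eq.
  - rewrite map_map. apply Forall_map, Forall_forall; intros x _; simpl; lia.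
  - destruct S; [easy|left; reflexivity].
Qed.

Lemma homogeneous_regB L us : 0 < L -> homogeneous OpConc OpAlt (regB L us).
Proof.
  intros HL. repeat split; try discriminate.
  - apply in_regB_children in H.
    destruct H as [(c & -> & _)|(S & -> & _ & _)]; easy.
  - apply in_regB_children in H.
    destruct H as [(c & -> & _)|(S & -> & HS & _)]; [easy|].
    simpl. destruct S; easy.
  - apply in_regB_children in H. intros l Hl.
    destruct H as [(c & -> & _)|(S & -> & _ & _)]; [easy|].
    simpl in Hl. apply in_map_iff in Hl. destruct Hl as (c & <- & _); auto.
  - unfold regB. cbn [levels]. f_equal. apply list_max_eq.
    + apply Forall_map, Forall_forall. intros r Hr. apply in_regB_children in Hr.
      destruct Hr as [(c & -> & _)|(S & -> & HS & _)]; simpl; [lia|].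
      rewrite list_max_letters; auto.
    + destruct L as [|L]; [lia|]. left; reflexivity.
Qed.

Lemma list_sum_const {A} (f : A -> nat) (l : list A) c :
  Forall (fun x => f x = c) l -> list_sum (map f l) = length l * c.
Proof. induction 1; simpl; lia. Qed.

Lemma size_conc rs : size (Conc rs) = list_sum (map size rs).
Proof. reflexivity. Qed.

Lemma size_regA d us :
  Forall (fun u => length u = d /\ binary u) us ->
  size (regA us) = length us * (d + 3).
Proof.
  intros H. unfold regA. rewrite size_conc, (list_sum_const _ _ 1).
  - rewrite length_flat_map, (list_sum_const _ _ (d + 3)); [lia|].
    eapply Forall_impl; [|exact H]. intros u [Hu _].
    unfold ablock. rewrite !length_app, length_map; simpl. lia.
  - apply Forall_forall. intros r Hr. apply in_regA_children in Hr.
    destruct Hr as [(c & ->)|(c & ->)]; auto.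
Qed.

Lemma size_alt S : size (alt S) = length S.
Proof.
  unfold alt. simpl. rewrite map_map, (list_sum_const _ _ 1); [lia|].
  apply Forall_forall; auto.
Qed.

(** Two universal parts of [L] five-letter unions each, the two fixed letters, and for every vector
    one three-letter union followed by [d] four-letter ones. *)
Lemma size_regB d L us :
  Forall (fun u => length u = d /\ binary u) us ->
  size (regB L us) = 10 * L + 2 + length us * (4 * d + 3).
Proof.
  intros H. unfold regB. rewrite size_conc, !map_app, !list_sum_app.
  assert (HU : list_sum (map size (universal L)) = 5 * L).
  { unfold universal. rewrite (list_sum_const _ _ 5).
    - rewrite repeat_length; lia.
    - apply Forall_forall. intros r Hr. apply repeat_spec in Hr; subst; auto. }
  rewrite HU. simpl map. simpl list_sum.
  enough (E : list_sum (map size (map alt (flat_map bblock us)))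
              = length us * (4 * d + 3)) by lia.
  clear HU. induction H as [|u us [Hu _] _ IH]; auto.
  cbn [flat_map]. rewrite !map_app, list_sum_app, IH. unfold bblock.
  cbn [map]. rewrite !map_map.
  match goal with |- list_sum (?a :: ?l) + _ = _ =>
    change (list_sum (a :: l)) with (3 + list_sum l) end.
  rewrite (list_sum_const _ _ 4); [simpl; lia|].
  apply Forall_forall. intros; rewrite size_alt; auto.
Qed.

Lemma over_alphabet_regA n us :
  4 < n -> Forall binary us -> over_alphabet n (regA us).
Proof.
  intros Hn H. unfold over_alphabet, regA. cbn [letters].
  apply Forall_flat_map, Forall_flat_map.
  eapply Forall_impl; [|exact H]. intros u Hu.
  unfold ablock, stay_left, stay_right, marker.
  apply Forall_app; split; [repeat constructor; lia|].
  apply Forall_app; split; [|repeat constructor; lia].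
  apply Forall_map. eapply Forall_impl; [|exact Hu].
  intros x Hx; simpl in Hx |- *.
  apply Forall_cons; [lia|apply Forall_nil].
Qed.

Lemma over_alphabet_regB n L us : 4 < n -> over_alphabet n (regB L us).
Proof.
  intros Hn. unfold over_alphabet, regB. cbn [letters].
  apply Forall_flat_map, Forall_forall. intros r Hr. apply in_regB_children in Hr.
  destruct Hr as [(c & -> & Hc)|(S & -> & _ & HS)].
  - apply Forall_cons; [lia|apply Forall_nil].
  - unfold alt; cbn [letters]. apply Forall_flat_map, Forall_map.
    eapply Forall_impl; [|exact HS]. intros c Hc; simpl in Hc |- *.
    apply Forall_cons; [lia|apply Forall_nil].
Qed.

(** * The expressions as sequences of numbers *)

Lemma flat_map_map {A B C} (f : A -> B) (g : B -> list C) l :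
  flat_map g (map f l) = flat_map (fun x => g (f x)) l.
Proof. induction l; simpl; f_equal; auto. Qed.

Lemma flat_map_flat_map {A B C} (f : A -> list B) (g : B -> list C) l :
  flat_map g (flat_map f l) = flat_map (fun x => flat_map g (f x)) l.
Proof. induction l; simpl; auto. rewrite flat_map_app; f_equal; auto. Qed.

Lemma length_flat_map_const {A B} (f : A -> list B) l c :
  Forall (fun x => length (f x) = c) l -> length (flat_map f l) = length l * c.
Proof. intros H. rewrite length_flat_map. apply list_sum_const; auto. Qed.

(** The entries are written as [[0] ++ [x] ++ []], the shape prefix, bit, suffix in which the
    program emits every clause; with it the output of a pass agrees with the encoding by
    computation. *)
Definition code_ablock (u : list nat) : list nat :=
  [3; 1; 0; 3; 0; 2] ++ flat_map (fun x => [0] ++ [x] ++ []) u ++ [3; 1; 0; 4].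

Definition code_bblock (u : list nat) : list nat :=
  [2; 3; 0; 2; 0; 3; 0; 4]
    ++ flat_map (fun x => [2; 4; 0; 0; 0] ++ [1 - x] ++ [0; 3; 0; 4]) u ++ [].

Definition universal_letter_code : list nat := [2; 5; 0; 0; 0; 1; 0; 2; 0; 3; 0; 4].

Definition code_universal (L : nat) : list nat :=
  concat (repeat universal_letter_code L).

Lemma encode_regA d us :
  Forall (fun u => length u = d /\ binary u) us ->
  encode_regexp (regA us)
  = 1 :: length us * (d + 3) :: flat_map code_ablock us.
Proof.
  intros H. unfold regA; cbn [encode_regexp]. f_equal. f_equal.
  - apply length_flat_map_const. eapply Forall_impl; [|exact H]. intros u [Hu _].
    unfold ablock. rewrite !length_app, length_map; simpl. lia.
  - rewrite flat_map_flat_map. apply flat_map_ext. intros u.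
    unfold ablock, code_ablock. rewrite !flat_map_app, flat_map_map. reflexivity.
Qed.

Lemma encode_universal L : flat_map encode_regexp (universal L) = code_universal L.
Proof.
  unfold universal, code_universal. rewrite flat_map_concat_map, map_repeat.
  reflexivity.
Qed.

Lemma encode_regB d L us :
  Forall (fun u => length u = d /\ binary u) us ->
  encode_regexp (regB L us)
  = 1 :: (2 * L + 2 + length us * (d + 1))
      :: code_universal L ++ [0; 3] ++ flat_map code_bblock us
         ++ [0; 4] ++ code_universal L.
Proof.
  intros H. unfold regB; cbn [encode_regexp]. f_equal. f_equal.
  - rewrite !length_app, length_map.
    rewrite (length_flat_map_const _ _ (d + 1)).
    + unfold universal. rewrite repeat_length. simpl. lia.
    + eapply Forall_impl; [|exact H]. intros u [Hu _].
      unfold bblock. simpl. rewrite length_map; lia.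
  - rewrite !flat_map_app, !encode_universal, flat_map_map, flat_map_flat_map.
    do 2 f_equal. f_equal. apply flat_map_ext. intros u.
    unfold bblock, code_bblock. cbn [flat_map]. rewrite flat_map_map, app_nil_r.
    reflexivity.
Qed.

(** * Half assignments *)

(** The binary digits of [a < N = 2 ^ H], most significant first, by repeated
    doubling modulo [N]: the machine cannot halve. *)
Fixpoint residue (N a v : nat) : nat :=
  match v with
  | 0 => a
  | S v => let r := 2 * residue N a v in if N <=? r then r - N else r
  end.

Definition digit (N a v : nat) : nat := if N <=? 2 * residue N a v then 1 else 0.

Lemma digit_le N a v : digit N a v <= 1.
Proof. unfold digit. destruct (_ <=? _); lia. Qed.

(** The form in which the machine proceeds: double, then subtract [N] as often as the digit says. *)
Lemma residue_S N a v :
  residue N a (S v) = 2 * residue N a v - digit N a v * N.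
Proof.
  unfold digit. cbn [residue]. cbv zeta. destruct (_ <=? _); lia.
Qed.

Lemma residue_lt N a v : a < N -> residue N a v < N.
Proof.
  intros H; induction v as [|v IH]; auto. cbn [residue]. cbv zeta.
  destruct (Nat.leb_spec N (2 * residue N a v)); lia.
Qed.

(** Because of this, counting through the numbers below [2 ^ H] exhausts the assignments of a
    half. *)
Lemma digits_onto (val : nat -> bool) H :
  exists a, a < 2 ^ H /\
    forall v, v < H -> digit (2 ^ H) a v = if val v then 1 else 0.
Proof.
  (* the number whose digits are [val v, ..., val (H - 1)] *)
  assert (Hb : exists b : nat -> nat,
    (forall v, v <= H -> b v < 2 ^ (H - v)) /\
    forall v, v < H ->
      b v = (if val v then 2 ^ (H - S v) else 0) + b (S v)).
  { exists (fun v => list_sum (map (fun w => if val w then 2 ^ (H - S w) else 0)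
                               (seq v (H - v)))).
    assert (E : forall v, v < H -> seq v (H - v) = v :: seq (S v) (H - S v)).
    { intros v Hv. replace (H - v) with (S (H - S v)) by lia. reflexivity. }
    split.
    - intros v Hv. remember (H - v) as k eqn:Ek. revert v Hv Ek.
      induction k as [|k IH]; intros v Hv Ek; [simpl; lia|].
      specialize (IH (S v)). cbn [seq map list_sum fold_right].
      replace (H - S v) with k by lia. rewrite Nat.pow_succ_r'.
      unfold list_sum in IH |- *. cbn [fold_right].
      destruct (val v); lia.
    - intros v Hv. rewrite (E v Hv). reflexivity. }
  destruct Hb as (b & Hlt & Hb).
  (* Reduction modulo [2 ^ H] has removed the first [v] digits, and [v] doublings have multiplied
     the tail [b v] by [2 ^ v]. *)
  assert (Hr : forall v, v <= H -> residue (2 ^ H) (b 0) v = 2 ^ v * b v).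
  { induction v as [|v IH]; intros Hv; [simpl; lia|].
    cbn [residue]. cbv zeta. rewrite IH by lia. rewrite (Hb v) by lia.
    assert (E : 2 ^ H = 2 ^ v * (2 * 2 ^ (H - S v))).
    { rewrite <- Nat.pow_succ_r', <- Nat.pow_add_r. f_equal. lia. }
    specialize (Hlt (S v)). rewrite Nat.pow_succ_r'.
    assert (Hp : 0 < 2 ^ v) by (apply Nat.neq_0_lt_0, Nat.pow_nonzero; lia).
    destruct (Nat.leb_spec (2 ^ H)
      (2 * (2 ^ v * ((if val v then 2 ^ (H - S v) else 0) + b (S v)))));
      rewrite E in *; destruct (val v); nia. }
  exists (b 0). split.
  - specialize (Hlt 0 (Nat.le_0_l H)). rewrite Nat.sub_0_r in Hlt. exact Hlt.
  - intros v Hv. unfold digit. rewrite Hr by lia. rewrite (Hb v) by lia.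
    assert (E : 2 ^ H = 2 ^ v * (2 * 2 ^ (H - S v))).
    { rewrite <- Nat.pow_succ_r', <- Nat.pow_add_r. f_equal. lia. }
    specialize (Hlt (S v)).
    assert (Hp : 0 < 2 ^ v) by (apply Nat.neq_0_lt_0, Nat.pow_nonzero; lia).
    destruct (Nat.leb_spec (2 ^ H)
      (2 * (2 ^ v * ((if val v then 2 ^ (H - S v) else 0) + b (S v)))));
      rewrite E in *; destruct (val v); auto; nia.
Qed.

(** [T] gives the truth value of every literal code, 0 for the literals that the
    half assignment leaves open. The truncated subtraction makes [unsat] 0 as soon
    as one literal is true. *)
Definition unsat (T : nat -> nat) (cl : clause) : nat :=
  fold_left (fun u l => u - T (encode_literal l)) cl 1.

Definition unsats (T : nat -> nat) (F : cnf) : list nat := map (unsat T) F.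

Definition half_table (H N lo a : nat) (T : nat -> nat) : Prop :=
  forall x (s : bool), x < 2 * H ->
    T (encode_literal (x, s)) =
      if (lo <=? x) && (x <? lo + H)
      then if s then digit N a (x - lo) else 1 - digit N a (x - lo)
      else 0.

Lemma unsat_le_1 T cl : unsat T cl <= 1.
Proof.
  assert (H : forall u, fold_left (fun u l => u - T (encode_literal l)) cl u <= u).
  { induction cl as [|l cl IH]; simpl; intros u; auto.
    specialize (IH (u - T (encode_literal l))). lia. }
  apply H.
Qed.

Lemma unsat_0 T cl :
  unsat T cl = 0 <-> exists l, In l cl /\ 0 < T (encode_literal l).
Proof.
  (* The generalised start needs [u <= 1]: a larger one could survive the subtraction of a single
     1. *)
  assert (H : forall u, u <= 1 ->
    (fold_left (fun u l => u - T (encode_literal l)) cl u = 0 <->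
     u = 0 \/ exists l, In l cl /\ 0 < T (encode_literal l))).
  { induction cl as [|l cl IH]; intros u Hu; simpl.
    - split; [auto|]. intros [H|(l & [] & _)]; auto.
    - rewrite IH by lia. split.
      + intros [H|(l' & Hl & H')].
        * destruct u; auto. right; exists l; split; auto; lia.
        * right; eauto.
      + intros [->|(l' & [->|Hl] & H')]; eauto; left; lia. }
  unfold unsat. rewrite H by lia. split; [intros [?|?]; [lia|]; auto | auto].
Qed.

Lemma unsats_binary T F :
  length (unsats T F) = length F /\ binary (unsats T F).
Proof.
  unfold unsats. split; [apply length_map|]. apply Forall_map, Forall_forall.
  intros cl _. pose proof (unsat_le_1 T cl). lia.
Qed.

Lemma compatible_map {A} (f g : A -> nat) (l : list A) :
  compatible (map f l) (map g l) <-> forall x, In x l -> f x = 0 \/ g x = 0.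
Proof.
  induction l as [|a l IH]; simpl.
  - split; [easy|constructor].
  - split.
    + intros H; inversion H; subst. intros x [<-|Hx]; auto. apply IH; auto.
    + intros H. constructor; auto. apply IH; auto.
Qed.

(** A true literal of a clause belongs to a variable of one of the halves and makes the bit of that
    half 0, so a clause is satisfied when one of its two bits is 0. The condition [n <= 2 * H] lets
    the halves cover all variables for odd [n] too. *)
Lemma satisfiable_iff_compatible k n F H (TA TB : nat -> nat -> nat) :
  is_kcnf k n F -> n <= 2 * H ->
  (forall a, half_table H (2 ^ H) 0 a (TA a)) ->
  (forall a, half_table H (2 ^ H) H a (TB a)) ->
  (satisfiable F <->
   exists a b, a < 2 ^ H /\ b < 2 ^ H /\ compatible (unsats (TA a) F) (unsats (TB b) F)).
Proof.
  intros [_ HF] Hn HA HB. split.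
  - intros (val & Hval).
    destruct (digits_onto val H) as (a & Ha & HTa).
    destruct (digits_onto (fun x => val (H + x)) H) as (b & Hb & HTb).
    exists a, b; repeat split; auto. apply compatible_map. intros cl Hcl.
    destruct (Hval cl Hcl) as ([x s] & Hl & E). simpl in E.
    assert (Hx : x < n) by (apply (proj2 (HF cl Hcl) _ Hl)).
    destruct (Nat.lt_ge_cases x H) as [Hlt|Hge].
    + left. apply unsat_0. exists (x, s); split; auto.
      rewrite HA by lia. rewrite Nat.sub_0_r, HTa by lia.
      destruct (Nat.leb_spec 0 x), (Nat.ltb_spec x (0 + H)); try lia. simpl.
      rewrite E. destruct s; lia.
    + right. apply unsat_0. exists (x, s); split; auto.
      rewrite HB by lia. rewrite HTb by lia.
      replace (H + (x - H)) with x by lia.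
      destruct (Nat.leb_spec H x), (Nat.ltb_spec x (H + H)); try lia. simpl.
      rewrite E. destruct s; lia.
  - intros (a & b & _ & _ & Hc).
    exists (fun x => if x <? H then digit (2 ^ H) a x =? 1
                     else digit (2 ^ H) b (x - H) =? 1).
    intros cl Hcl. unfold unsats in Hc. rewrite compatible_map in Hc.
    destruct (Hc cl Hcl) as [Hu|Hu]; apply unsat_0 in Hu;
      destruct Hu as ([x s] & Hl & Hpos); exists (x, s); split; auto; simpl;
      assert (Hx : x < n) by (apply (proj2 (HF cl Hcl) _ Hl)).
    + rewrite HA in Hpos by lia. rewrite Nat.sub_0_r in Hpos.
      destruct (Nat.leb_spec 0 x), (Nat.ltb_spec x (0 + H)); cbn [andb] in Hpos; try lia.
      destruct (Nat.ltb_spec x H); [|lia].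
      pose proof (digit_le (2 ^ H) a x).
      destruct s; destruct (Nat.eqb_spec (digit (2 ^ H) a x) 1); auto; lia.
    + rewrite HB in Hpos by lia.
      destruct (Nat.leb_spec H x), (Nat.ltb_spec x (H + H)); cbn [andb] in Hpos; try lia.
      destruct (Nat.ltb_spec x H); [lia|].
      pose proof (digit_le (2 ^ H) b (x - H)).
      destruct s; destruct (Nat.eqb_spec (digit (2 ^ H) b (x - H)) 1); auto; lia.
Qed.

(** * A structured language over the machine *)

(** [For j c] repeats [c] as often as register [j] says; the register counts
    down. Its compilation relies on a nonzero value, and the countdown on the
    value 1, in register [one]. *)
Definition one : nat := 1.

Inductive cmd : Type :=
| Blk (l : list instr)
| Seq (c1 c2 : cmd)
| For (j : nat) (c : cmd).

(** Registers as a list, with value 0 beyond its end. *)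
Definition state : Type := (list nat * (nat -> nat))%type.

Fixpoint set_reg (l : list nat) (i v : nat) : list nat :=
  match i, l with
  | 0, [] => [v]
  | 0, _ :: l => v :: l
  | S i, [] => 0 :: set_reg [] i v
  | S i, x :: l => x :: set_reg l i v
  end.

Definition set_mem (M : nat -> nat) (i v : nat) : nat -> nat := update M i v.

Definition step (a : instr) (s : state) : state :=
  match a with
  | IConst i v => (set_reg (fst s) i v, snd s)
  | IAdd i j k => (set_reg (fst s) i (nth j (fst s) 0 + nth k (fst s) 0), snd s)
  | ISub i j k => (set_reg (fst s) i (nth j (fst s) 0 - nth k (fst s) 0), snd s)
  | ILoad i j => (set_reg (fst s) i (snd s (nth j (fst s) 0)), snd s)
  | IStore i j => (fst s, set_mem (snd s) (nth i (fst s) 0) (nth j (fst s) 0))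
  | IJumpPos _ _ => s
  end.

(** Evaluation keeps all values at most [V], whence every instruction costs at
    most [2 * bitlen V] and the time follows from the number of instructions. *)
Definition keeps_bound (V : nat) (a : instr) (s : state) : Prop :=
  match a with
  | IConst _ v => v <= V
  | IAdd _ j k => nth j (fst s) 0 + nth k (fst s) 0 <= V
  | IJumpPos _ _ => False
  | _ => True
  end.

(** The 2 of a stopping loop pays for the jump on entry and for the last test. The 2 of a round pays
    for its test and its decrement; the jump on entry, taken only once, is already contained in
    [t']. *)
Inductive eval (V : nat) : cmd -> state -> nat -> state -> Prop :=
| eval_nil s : eval V (Blk []) s 0 s
| eval_cons a l s t s' :
    keeps_bound V a s -> eval V (Blk l) (step a s) t s' ->
    eval V (Blk (a :: l)) s (S t) s'
| eval_seq c1 c2 s t1 s1 t2 s2 :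
    eval V c1 s t1 s1 -> eval V c2 s1 t2 s2 -> eval V (Seq c1 c2) s (t1 + t2) s2
| eval_for_stop j c s :
    nth one (fst s) 0 <> 0 -> nth j (fst s) 0 = 0 -> eval V (For j c) s 2 s
| eval_for_loop j c s t s1 t' s2 :
    nth one (fst s) 0 <> 0 -> nth j (fst s) 0 <> 0 ->
    eval V c s t s1 -> eval V (For j c) (step (ISub j j one) s1) t' s2 ->
    eval V (For j c) s (t + 2 + t') s2.

(** Jump targets are absolute, hence the address [off] of the first instruction. A loop has its test
    at the bottom: its first instruction jumps there, always, as register [one] is nonzero, and the
    test jumps back to the body. *)
Fixpoint compile (off : nat) (c : cmd) : list instr :=
  match c with
  | Blk l => l
  | Seq c1 c2 =>
      let l := compile off c1 in l ++ compile (off + length l) c2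
  | For j c =>
      let l := compile (S off) c in
      IJumpPos one (off + length l + 2) :: l ++ [ISub j j one; IJumpPos j (S off)]
  end.

(** * Correctness of the compilation *)

Definition values_below (V : nat) (s : state) : Prop :=
  (forall i, nth i (fst s) 0 <= V) /\ forall i, snd s i <= V.

Definition conf (p : nat) (s : state) : config :=
  Config p (fun i => nth i (fst s) 0) (snd s).

(** Unlike [runs], it may end before the program halts, so that stretches of code compose. *)
Inductive reaches (P : program) : config -> nat -> config -> Prop :=
| reaches_refl c : reaches P c 0 c
| reaches_step c a t c' :
    nth_error P (pc c) = Some a -> reaches P (exec a c) t c' ->
    reaches P c (cost a c + t) c'.

Lemma reaches_trans P c1 t1 c2 t2 c3 :
  reaches P c1 t1 c2 -> reaches P c2 t2 c3 -> reaches P c1 (t1 + t2) c3.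
Proof.
  induction 1; intros H2; auto. rewrite <- Nat.add_assoc. econstructor; eauto.
Qed.

Lemma reaches_runs P c1 t1 c2 t2 c3 :
  reaches P c1 t1 c2 -> runs P c2 t2 c3 -> runs P c1 (t1 + t2) c3.
Proof.
  induction 1; intros H2; auto. rewrite <- Nat.add_assoc. econstructor; eauto.
Qed.

Lemma nth_set_reg l i v j :
  nth j (set_reg l i v) 0 = if j =? i then v else nth j l 0.
Proof.
  revert l j; induction i as [|i IH]; intros [|x l] [|j]; simpl; auto.
  - destruct j; auto.
  - rewrite IH. destruct (j =? i), j; auto.
Qed.

Lemma exec_conf a p s :
  (forall j l, a <> IJumpPos j l) -> exec a (conf p s) = conf (S p) (step a s).
Proof.
  destruct s as [R M]. intros H.
  assert (E : forall i v,
    update (fun i => nth i R 0) i v = fun j => nth j (set_reg R i v) 0).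
  { intros i v. apply functional_extensionality. intros j.
    rewrite nth_set_reg. reflexivity. }
  destruct a; unfold conf; simpl; rewrite ?E; auto. edestruct H; eauto.
Qed.

Lemma bitlen_mono x y : x <= y -> bitlen x <= bitlen y.
Proof. intros H. unfold bitlen. apply le_n_S, Nat.log2_le_mono; auto. Qed.

Lemma values_below_cost V a p s :
  values_below V s -> keeps_bound V a s \/ (exists j l, a = IJumpPos j l) ->
  cost a (conf p s) <= 2 * bitlen V.
Proof.
  intros [HR HM] Hk. destruct s as [R M]; cbn [fst snd] in *.
  assert (HR' : forall i, bitlen (nth i R 0) <= bitlen V)
    by (intros; apply bitlen_mono; auto).
  assert (HM' : forall i, bitlen (M i) <= bitlen V)
    by (intros; apply bitlen_mono; auto).
  destruct a as [i c|i j k|i j k|i j|i j|j l];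
    cbn [cost conf reg mem fst snd keeps_bound] in *.
  - assert (bitlen c <= bitlen V); [|lia].
    apply bitlen_mono. destruct Hk as [Hk|(? & ? & ?)]; [auto|discriminate].
  - pose proof (HR' j); pose proof (HR' k); lia.
  - pose proof (HR' j); pose proof (HR' k); lia.
  - pose proof (HR' j); pose proof (HM' (nth j R 0)); lia.
  - pose proof (HR' i); pose proof (HR' j); lia.
  - pose proof (HR' j); lia.
Qed.

Lemma values_below_step V a s :
  values_below V s -> keeps_bound V a s -> values_below V (step a s).
Proof.
  intros [HR HM] Hk. destruct s as [R M]; simpl in *.
  assert (HS : forall i v, v <= V -> forall j, nth j (set_reg R i v) 0 <= V).
  { intros i v Hv j. rewrite nth_set_reg. destruct (j =? i); auto. }
  destruct a as [i c|i j k|i j k|i j|i j|j l]; simpl in *; try easy;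
    split; simpl; auto.
  - apply HS. specialize (HR j). lia.
  - intros x. unfold set_mem, update. destruct (x =? _); auto.
Qed.

(** The last conjunct starts at the test of the loop: there the remaining
    iterations begin, to which the induction hypothesis on a loop refers. *)
Definition simulates (P : program) (V off : nat) (c : cmd) (s : state) (t : nat)
    (s' : state) : Prop :=
  values_below V s' /\
  (exists t0, reaches P (conf off s) t0 (conf (off + length (compile off c)) s')
     /\ t0 <= t * (2 * bitlen V)) /\
  match c with
  | For j b =>
      exists t0, reaches P (conf (off + length (compile (S off) b) + 2) s) t0
        (conf (off + length (compile off c)) s')
      /\ t0 + 2 * bitlen V <= t * (2 * bitlen V)
  | _ => True
  end.

Lemma nth_error_middle {A} (l1 l2 : list A) x :
  nth_error (l1 ++ x :: l2) (length l1) = Some x.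
Proof. rewrite nth_error_app2, Nat.sub_diag; auto. Qed.

Lemma nth_error_at {A} (l l1 l2 : list A) k x :
  l = l1 ++ x :: l2 -> k = length l1 -> nth_error l k = Some x.
Proof. intros -> ->. apply nth_error_middle. Qed.

Lemma reaches_instr P V a p s t c' :
  nth_error P p = Some a -> values_below V s -> keeps_bound V a s ->
  reaches P (conf (S p) (step a s)) t c' ->
  exists t0, reaches P (conf p s) t0 c' /\ t0 <= 2 * bitlen V + t.
Proof.
  intros Hn Hb Hk H. exists (cost a (conf p s) + t). split.
  - apply reaches_step; auto. rewrite exec_conf; auto.
    intros j l ->; exact Hk.
  - pose proof (values_below_cost V a p s Hb (or_introl Hk)). lia.
Qed.

Lemma reaches_jump P V j l p s t c' :
  nth_error P p = Some (IJumpPos j l) -> values_below V s ->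
  reaches P (conf (if nth j (fst s) 0 =? 0 then S p else l) s) t c' ->
  exists t0, reaches P (conf p s) t0 c' /\ t0 <= 2 * bitlen V + t.
Proof.
  intros Hn Hb H. exists (cost (IJumpPos j l) (conf p s) + t). split.
  - apply reaches_step; auto.
  - pose proof (values_below_cost V (IJumpPos j l) p s Hb
      (or_intror (ex_intro _ j (ex_intro _ l eq_refl)))). lia.
Qed.

Lemma for_layout P pre post j c :
  P = pre ++ compile (length pre) (For j c) ++ post ->
  let l := compile (S (length pre)) c in
  let test := length pre + length l + 2 in
  nth_error P (length pre) = Some (IJumpPos one test) /\
  nth_error P (S (length pre) + length l) = Some (ISub j j one) /\
  nth_error P test = Some (IJumpPos j (S (length pre))) /\
  length pre + length (compile (length pre) (For j c)) = S test.
Proof.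
  intros ->. cbn [compile]. cbv zeta.
  set (l := compile (S (length pre)) c). set (test := length pre + length l + 2).
  repeat split.
  - simpl. apply nth_error_middle.
  - apply (nth_error_at _ (pre ++ IJumpPos one test :: l)
             (IJumpPos j (S (length pre)) :: post)).
    + rewrite <- !app_assoc; simpl; rewrite <- app_assoc; reflexivity.
    + rewrite length_app; simpl; lia.
  - apply (nth_error_at _ (pre ++ IJumpPos one test :: l ++ [ISub j j one]) post).
    + rewrite <- !app_assoc; simpl; rewrite <- !app_assoc; reflexivity.
    + rewrite length_app; simpl; rewrite length_app; simpl; unfold test; lia.
  - simpl. rewrite length_app. simpl. unfold test. lia.
Qed.

Lemma compile_correct V c s t s' :
  eval V c s t s' ->
  forall P pre post, P = pre ++ compile (length pre) c ++ post -> values_below V s ->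
  simulates P V (length pre) c s t s'.
Proof.
  induction 1 as [s|a l s t s' Hk _ IH|c1 c2 s t1 s1 t2 s2 _ IH1 _ IH2
                 |j c s Hone Hj|j c s t s1 t' s2 Hone Hj _ IH1 _ IH2];
    intros P pre post EP Hb; unfold simulates.
  - split; auto. split; auto. exists 0. simpl. rewrite Nat.add_0_r.
    split; [apply reaches_refl | lia].
  - assert (EP' : P = (pre ++ [a]) ++ compile (length (pre ++ [a])) (Blk l) ++ post).
    { rewrite EP, <- app_assoc; reflexivity. }
    destruct (IH P _ _ EP' (values_below_step _ _ _ Hb Hk)) as (Hb' & (t0 & H0 & Ht) & _).
    split; auto. split; auto. rewrite length_app in H0. simpl in H0.
    replace (length pre + 1) with (S (length pre)) in H0 by lia.
    destruct (reaches_instr P V a (length pre) s t0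
                (conf (S (length pre) + length l) s')) as (t1 & H1 & Ht1); auto.
    { rewrite EP. apply nth_error_middle. }
    exists t1. split.
    + replace (length pre + length (compile (length pre) (Blk (a :: l))))
        with (S (length pre + length l)) by (simpl; lia). exact H1.
    + lia.
  - cbn [compile] in EP. cbv zeta in EP. rewrite <- app_assoc in EP.
    destruct (IH1 P _ _ EP Hb) as (Hb1 & (ta & Ha & Hta) & _).
    rewrite app_assoc in EP. set (l1 := compile (length pre) c1) in *.
    rewrite <- length_app in EP.
    destruct (IH2 P _ _ EP Hb1) as (Hb2 & (tb & Hb' & Htb) & _).
    split; auto. split; auto. exists (ta + tb). split; [|lia].
    eapply reaches_trans; [exact Ha|].
    cbn [compile]; cbv zeta. fold l1. rewrite length_app, Nat.add_assoc.
    rewrite <- length_app. exact Hb'.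
  - destruct (for_layout P pre post j c EP) as (N0 & _ & N2 & E).
    cbv zeta in *. rewrite E. set (test := length pre + _ + 2) in *.
    destruct (reaches_jump P V j (S (length pre)) test s 0 (conf (S test) s))
      as (t0 & H0 & Ht0); auto.
    { rewrite Hj. apply reaches_refl. }
    split; auto. split.
    + destruct (reaches_jump P V one test (length pre) s t0 (conf (S test) s))
        as (t1 & H1 & Ht1); auto.
      { apply Nat.eqb_neq in Hone. rewrite Hone. exact H0. }
      exists t1. split; auto. lia.
    + exists t0. split; auto. lia.
  - destruct (for_layout P pre post j c EP) as (N0 & N1 & N2 & E).
    assert (EP' : P = (pre ++ [IJumpPos one
          (length pre + length (compile (S (length pre)) c) + 2)])
        ++ compile (length (pre ++ [IJumpPos one
          (length pre + length (compile (S (length pre)) c) + 2)])) c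
        ++ [ISub j j one; IJumpPos j (S (length pre))] ++ post).
    { rewrite length_app, Nat.add_1_r, <- app_assoc.
      rewrite EP at 1. cbn [compile]; cbv zeta. f_equal. simpl. f_equal.
      rewrite <- app_assoc. reflexivity. }
    destruct (IH1 P _ _ EP' Hb) as (Hb1 & (tb & Hbody & Htb) & _).
    rewrite length_app in Hbody. cbn [length] in Hbody.
    rewrite Nat.add_1_r in Hbody.
    assert (Hb1' : values_below V (step (ISub j j one) s1))
      by (apply values_below_step; simpl; auto).
    (* Only the part of the hypothesis that starts at the test is of use: the remaining rounds do
       not pass through the entry jump again. *)
    destruct (IH2 P pre post EP Hb1') as (Hb2 & _ & (tr & Hrest & Htr)).
    cbv zeta in *. rewrite E in *.
    set (l := compile (S (length pre)) c) in *.
    set (test := length pre + length l + 2) in *.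
    assert (Hloop : exists t0, reaches P (conf test s) t0 (conf (S test) s2)
              /\ t0 + 2 * bitlen V <= (t + 2 + t') * (2 * bitlen V)).
    { destruct (reaches_instr P V (ISub j j one) (S (length pre) + length l) s1 tr
                  (conf (S test) s2)) as (td & Hd & Htd); [auto|auto|exact Logic.I| |].
      { replace (S (S (length pre) + length l)) with test by (unfold test; lia).
        exact Hrest. }
      destruct (reaches_jump P V j (S (length pre)) test s (tb + td)
                  (conf (S test) s2)) as (t0 & H0 & Ht0); auto.
      { apply Nat.eqb_neq in Hj. rewrite Hj.
        eapply reaches_trans; [exact Hbody | exact Hd]. }
      exists t0. split; auto. rewrite !Nat.mul_add_distr_r. lia. }
    destruct Hloop as (t0 & H0 & Ht0).
    split; auto. split.
    + destruct (reaches_jump P V one test (length pre) s t0 (conf (S test) s2))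
        as (t1 & H1 & Ht1); auto.
      { apply Nat.eqb_neq in Hone. rewrite Hone. exact H0. }
      exists t1. split; auto. lia.
    + exists t0. split; auto.
Qed.

Definition shift (off : nat) (a : instr) : instr :=
  match a with IJumpPos j l => IJumpPos j (off + l) | _ => a end.

(** Jumps are relocated by the length of the prefix. As nothing follows [P], leaving it at the end
    still means halting. *)
Lemma runs_shift P c t c' : runs P c t c' -> forall pre,
  runs (pre ++ map (shift (length pre)) P)
    (Config (length pre + pc c) (reg c) (mem c)) t
    (Config (length pre + pc c') (reg c') (mem c')).
Proof.
  induction 1 as [c Hn|c a t c' Hn _ IH]; intros pre.
  - apply runs_halt. simpl. rewrite nth_error_app2 by lia.
    replace (length pre + pc c - length pre) with (pc c) by lia.
    rewrite nth_error_map, Hn. reflexivity.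
  - set (c0 := Config (length pre + pc c) (reg c) (mem c)).
    replace (cost a c) with (cost (shift (length pre) a) c0)
      by (destruct a; reflexivity).
    apply runs_step.
    + simpl. rewrite nth_error_app2 by lia.
      replace (length pre + pc c - length pre) with (pc c) by lia.
      rewrite nth_error_map, Hn. reflexivity.
    + replace (exec (shift (length pre) a) c0) with
        (Config (length pre + pc (exec a c)) (reg (exec a c)) (mem (exec a c)));
        [apply IH|].
      destruct a; simpl; rewrite ?Nat.add_succ_r; auto.
      destruct (reg c j =? 0); rewrite ?Nat.add_succ_r; auto.
Qed.

(** * Total correctness with a bound on the number of instructions *)

Definition wp (V : nat) (c : cmd) (t : nat) (Q : state -> Prop) (s : state) : Prop :=
  exists t' s', eval V c s t' s' /\ t' <= t /\ Q s'.

Lemma wp_nil V (Q : state -> Prop) s : Q s -> wp V (Blk []) 0 Q s.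
Proof. intros H; exists 0, s; repeat split; auto. constructor. Qed.

Lemma wp_cons V a l t (Q : state -> Prop) s :
  keeps_bound V a s -> wp V (Blk l) t Q (step a s) -> wp V (Blk (a :: l)) (S t) Q s.
Proof.
  intros Hk (t' & s' & H & Ht & HQ). exists (S t'), s'; repeat split; auto; [|lia].
  constructor; auto.
Qed.

Lemma wp_app V l1 l2 t1 t2 (Q : state -> Prop) s :
  wp V (Blk l1) t1 (wp V (Blk l2) t2 Q) s -> wp V (Blk (l1 ++ l2)) (t1 + t2) Q s.
Proof.
  intros (t' & s' & H & Ht & (t'' & s'' & H2 & Ht2 & HQ)).
  exists (t' + t''), s''; repeat split; auto; [|lia].
  clear Ht. remember (Blk l1) as c eqn:Ec. revert l1 Ec.
  induction H; intros l1 Ec; inversion Ec; subst; auto.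
  simpl. constructor; auto.
Qed.

Lemma wp_seq V c1 c2 t1 t2 (Q : state -> Prop) s :
  wp V c1 t1 (wp V c2 t2 Q) s -> wp V (Seq c1 c2) (t1 + t2) Q s.
Proof.
  intros (t' & s' & H & Ht & (t'' & s'' & H2 & Ht2 & HQ)).
  exists (t' + t''), s''; repeat split; auto; [|lia]. econstructor; eauto.
Qed.

Lemma wp_weaken V c t t' (Q Q' : state -> Prop) s :
  wp V c t Q s -> t <= t' -> (forall s', Q s' -> Q' s') -> wp V c t' Q' s.
Proof.
  intros (t0 & s' & H & Ht & HQ) Hle Himp. exists t0, s'; repeat split; auto; lia.
Qed.

(** The invariant is indexed by the rounds still to go, which is the content of register [j]; it is
    restored only after the decrement that the loop appends to its body. *)
Lemma wp_for V j c t (I : nat -> state -> Prop) k s :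
  (forall k s, I k s -> nth one (fst s) 0 = 1 /\ nth j (fst s) 0 = k) ->
  (forall k s, I (S k) s -> wp V c t (fun s' => I k (step (ISub j j one) s')) s) ->
  I k s -> wp V (For j c) (2 + k * (t + 2)) (I 0) s.
Proof.
  intros Hreg Hbody. revert s; induction k as [|k IH]; intros s Hs;
    destruct (Hreg _ _ Hs) as [H1 Hj].
  - exists 2, s; repeat split; auto. apply eval_for_stop; auto. rewrite H1; easy.
  - destruct (Hbody k s Hs) as (t1 & s1 & He & Ht1 & HI).
    destruct (IH _ HI) as (t2 & s2 & He2 & Ht2 & HQ).
    exists (t1 + 2 + t2), s2; repeat split; auto; [|simpl; lia].
    eapply eval_for_loop; eauto; [rewrite H1; easy | rewrite Hj; easy].
Qed.

(** * The reduction as a program *)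

(** Below address [S] the output written so far, then the copy of the input,
    then the table [T]. *)
Definition memory (S : nat) (inp out : list nat) (T : nat -> nat) : nat -> nat :=
  fun i => if i <? S then nth i out 0
           else if i <? S + length inp then nth (i - S) inp 0
           else T (i - (S + length inp)).

Lemma memory_emit S inp out T v :
  length out < S ->
  set_mem (memory S inp out T) (length out) v = memory S inp (out ++ [v]) T.
Proof.
  intros H. apply functional_extensionality. intros i.
  unfold set_mem, update, memory.
  destruct (Nat.eqb_spec i (length out)) as [->|Hne].
  - destruct (Nat.ltb_spec (length out) S); [|lia]. rewrite nth_middle; auto.
  - destruct (Nat.ltb_spec i S); auto.
    destruct (Nat.lt_ge_cases i (length out)).
    + rewrite app_nth1; auto.
    + rewrite !nth_overflow; auto; rewrite ?length_app; simpl; lia.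
Qed.

Lemma memory_input S inp1 x inp2 out T :
  memory S (inp1 ++ x :: inp2) out T (S + length inp1) = x.
Proof.
  unfold memory. rewrite length_app. simpl length.
  destruct (Nat.ltb_spec (S + length inp1) S); [lia|].
  destruct (Nat.ltb_spec (S + length inp1) (S + (length inp1 + Datatypes.S (length inp2))));
    [|lia].
  replace (S + length inp1 - S) with (length inp1) by lia. apply nth_middle.
Qed.

Lemma memory_table S inp out T i : memory S inp out T (S + length inp + i) = T i.
Proof.
  unfold memory.
  destruct (Nat.ltb_spec (S + length inp + i) S); [lia|].
  destruct (Nat.ltb_spec (S + length inp + i) (S + length inp)); [lia|].
  f_equal; lia.
Qed.

Lemma memory_set_table S inp out T i v :
  set_mem (memory S inp out T) (S + length inp + i) v
  = memory S inp out (set_mem T i v).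
Proof.
  apply functional_extensionality. intros j. unfold set_mem, update, memory.
  destruct (Nat.eqb_spec j (S + length inp + i)) as [->|Hne].
  - destruct (Nat.ltb_spec (S + length inp + i) S); [lia|].
    destruct (Nat.ltb_spec (S + length inp + i) (S + length inp)); [lia|].
    destruct (Nat.eqb_spec (S + length inp + i - (S + length inp)) i); lia.
  - destruct (Nat.ltb_spec j S); auto.
    destruct (Nat.ltb_spec j (S + length inp)); auto.
    destruct (Nat.eqb_spec (j - (S + length inp)) i); auto; lia.
Qed.

(** Registers: 0 input length, 1 constant 1, 2 number of variables, 3 number of
    clauses, 4 [H], 5 [N], 6 [L], 7 start of the input copy, 8 start of the table,
    9 output pointer, 10 constant 0, 11 and above temporaries. *)
Definition emit_reg (r : nat) : list instr := [IStore 9 r; IAdd 9 9 one].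

Definition emit (l : list nat) : list instr :=
  flat_map (fun c => IConst 11 c :: emit_reg 11) l.

(** Registers 15 and 16 point to the table entries of the assigned and of the open half. The counter
    in register 12 exceeds the assignment by 1, hence [ISub 17 12 one]. With [r] the residue in
    register 17, the difference [2 r + 1 - N] is positive just when the digit is 1, and two
    subtractions from 1 turn it into the negated digit in 18 and the digit in 19. The loop on
    register 14, of one round or none, is a conditional subtraction. Adding register 10, which is 0,
    copies a register. *)
Definition decode (lo_half : bool) : cmd :=
  Seq (Blk (if lo_half
            then [IAdd 15 8 10; IAdd 16 4 4; IAdd 16 16 8; ISub 17 12 one; IAdd 13 4 10]
            else [IAdd 16 8 10; IAdd 15 4 4; IAdd 15 15 8; ISub 17 12 one; IAdd 13 4 10]))
  (For 13
    (Seq (Blk [IAdd 17 17 17; IAdd 19 17 one; ISub 19 19 5; ISub 18 one 19;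
               ISub 19 one 18; IAdd 14 19 10])
    (Seq (For 14 (Blk [ISub 17 17 5]))
         (Blk [IStore 15 18; IAdd 15 15 one; IStore 15 19; IAdd 15 15 one;
               IStore 16 10; IAdd 16 16 one; IStore 16 10; IAdd 16 16 one])))).

(** Reading starts 2 cells into the input copy, behind the numbers of variables and of clauses.
    Register 18 ends as the [unsat] bit and 19 as its complement, the one that [regB] needs. *)
Definition clauses (neg : bool) (cpre cpost : list nat) : cmd :=
  Seq (Blk [IConst 11 2; IAdd 15 7 11; IAdd 13 3 10])
  (For 13
    (Seq (Blk [ILoad 14 15; IAdd 15 15 one; IConst 18 1])
    (Seq (For 14 (Blk [ILoad 16 15; IAdd 15 15 one; IAdd 16 16 8; ILoad 16 16;
                       ISub 18 18 16]))
         (Blk ([ISub 19 one 18] ++ emit cpre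
                 ++ emit_reg (if neg then 19 else 18) ++ emit cpost))))).

Definition pass (lo_half neg : bool) (pre cpre cpost post : list nat) : cmd :=
  Seq (Blk [IAdd 12 5 10])
  (For 12
    (Seq (Blk (emit pre))
    (Seq (decode lo_half)
    (Seq (clauses neg cpre cpost)
         (Blk (emit post)))))).

Definition emit_universal : cmd :=
  Seq (Blk [IAdd 12 6 10])
      (For 12 (Blk (emit universal_letter_code))).

(** Indexed by literal codes; the half assignment is that of the variables from
    [lo] on. *)
Definition table (H N lo a : nat) : nat -> nat :=
  fun i => let x := i / 2 in
    if (lo <=? x) && (x <? lo + H)
    then if Nat.odd i then digit N a (x - lo) else 1 - digit N a (x - lo)
    else 0.

Lemma literal_div2 x (s : bool) : encode_literal (x, s) / 2 = x.
Proof.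
  unfold encode_literal; cbn [fst snd]. symmetry.
  apply (Nat.div_unique _ 2 _ (if s then 1 else 0)); destruct s; lia.
Qed.

Lemma literal_odd x (s : bool) : Nat.odd (encode_literal (x, s)) = s.
Proof.
  unfold encode_literal; cbn [fst snd]. rewrite Nat.odd_add, Nat.odd_mul.
  destruct s; reflexivity.
Qed.

Lemma half_table_table H N lo a : half_table H N lo a (table H N lo a).
Proof.
  intros x s _. unfold table. rewrite literal_div2, literal_odd. reflexivity.
Qed.

Lemma literal_cover i : exists x s, i = encode_literal (x, s).
Proof.
  destruct (Nat.Even_or_Odd i) as [[x ->]|[x ->]].
  - exists x, false. unfold encode_literal; simpl; lia.
  - exists x, true. unfold encode_literal; simpl; lia.
Qed.

(** [table] after [v] rounds of [decode], starting from [T]. *)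
Definition partial_table (H N lo lo' a v : nat) (T : nat -> nat) : nat -> nat :=
  fun i => let x := i / 2 in
    if (lo <=? x) && (x <? lo + v)
    then if Nat.odd i then digit N a (x - lo) else 1 - digit N a (x - lo)
    else if (lo' <=? x) && (x <? lo' + v) then 0 else T i.

Lemma partial_table_full H N lo lo' a T :
  (lo = 0 /\ lo' = H \/ lo = H /\ lo' = 0) ->
  (forall i, 4 * H <= i -> T i = 0) ->
  partial_table H N lo lo' a H T = table H N lo a.
Proof.
  intros Hlo HT. apply functional_extensionality. intros i.
  destruct (literal_cover i) as (x & s & ->).
  unfold partial_table, table. rewrite literal_div2, literal_odd. cbv zeta.
  destruct (Nat.leb_spec lo x), (Nat.ltb_spec x (lo + H)); cbn [andb]; auto;
  destruct (Nat.leb_spec lo' x), (Nat.ltb_spec x (lo' + H)); cbn [andb]; auto;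
    try lia; apply HT; unfold encode_literal; cbn [fst snd]; lia.
Qed.

Lemma partial_table_0 H N lo lo' a T : partial_table H N lo lo' a 0 T = T.
Proof.
  apply functional_extensionality. intros i. unfold partial_table. cbv zeta.
  destruct (Nat.leb_spec lo (i / 2)), (Nat.ltb_spec (i / 2) (lo + 0)); cbn [andb];
  destruct (Nat.leb_spec lo' (i / 2)), (Nat.ltb_spec (i / 2) (lo' + 0)); cbn [andb];
    auto; lia.
Qed.

(** The four writes are those of one round of [decode]: both literals of an assigned variable, then
    both of an open one. *)
Lemma partial_table_S H N lo lo' a v T :
  (lo = 0 /\ lo' = H \/ lo = H /\ lo' = 0) -> v < H ->
  set_mem (set_mem (set_mem (set_mem (partial_table H N lo lo' a v T)
      (2 * (lo + v)) (1 - digit N a v)) (2 * (lo + v) + 1) (digit N a v))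
      (2 * (lo' + v)) 0) (2 * (lo' + v) + 1) 0
  = partial_table H N lo lo' a (S v) T.
Proof.
  intros Hlo Hv. apply functional_extensionality. intros i.
  destruct (literal_cover i) as (x & s & ->).
  unfold partial_table, set_mem, update. rewrite literal_div2, literal_odd. cbv zeta.
  unfold encode_literal; cbn [fst snd].
  destruct (Nat.eqb_spec (2 * x + (if s then 1 else 0)) (2 * (lo' + v) + 1));
  [|destruct (Nat.eqb_spec (2 * x + (if s then 1 else 0)) (2 * (lo' + v)));
  [|destruct (Nat.eqb_spec (2 * x + (if s then 1 else 0)) (2 * (lo + v) + 1));
  [|destruct (Nat.eqb_spec (2 * x + (if s then 1 else 0)) (2 * (lo + v)))]]];
  destruct s; try lia;
  destruct (Nat.leb_spec lo x), (Nat.ltb_spec x (lo + v)),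
    (Nat.ltb_spec x (lo + S v)); cbn [andb]; try lia;
  destruct (Nat.leb_spec lo' x), (Nat.ltb_spec x (lo' + v)),
    (Nat.ltb_spec x (lo' + S v)); cbn [andb]; try lia; auto;
  repeat f_equal; lia.
Qed.

Ltac instr_step :=
  apply wp_cons;
  [cbn [keeps_bound nth fst snd one] | cbn [step set_reg nth fst snd one]].

Ltac same_state :=
  apply (f_equal2 pair);
  [repeat (apply (f_equal2 cons); [first [reflexivity | lia | nia] |]); reflexivity
  | reflexivity].

Lemma wp_for_invariant V j c t (I : nat -> state -> Prop) k t' (Q : state -> Prop) s :
  I k s ->
  (forall k s, I k s -> nth one (fst s) 0 = 1 /\ nth j (fst s) 0 = k) ->
  (forall k s, I (S k) s -> wp V c t (fun s' => I k (step (ISub j j one) s')) s) ->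
  2 + k * (t + 2) <= t' ->
  (forall s, I 0 s -> Q s) -> wp V (For j c) t' Q s.
Proof.
  intros. eapply wp_weaken; [eapply wp_for|..]; eauto.
Qed.

Lemma wp_seq_le V c1 c2 t1 t2 t (Q : state -> Prop) s :
  wp V c1 t1 (wp V c2 t2 Q) s -> t1 + t2 <= t -> wp V (Seq c1 c2) t Q s.
Proof. intros. eapply wp_weaken; [apply wp_seq|..]; eauto. Qed.

Lemma wp_emit V S inp T a0 a2 a3 a4 a5 a6 a7 a8 a10 R l (Q : state -> Prop) :
  S <= V -> Forall (fun c => c <= V) l ->
  forall out a11,
  length out + length l <= S ->
  (forall x, Q (a0 :: 1 :: a2 :: a3 :: a4 :: a5 :: a6 :: a7 :: a8
                   :: length (out ++ l) :: a10 :: x :: R, memory S inp (out ++ l) T)) ->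
  wp V (Blk (emit l)) (3 * length l) Q
    (a0 :: 1 :: a2 :: a3 :: a4 :: a5 :: a6 :: a7 :: a8
        :: length out :: a10 :: a11 :: R, memory S inp out T).
Proof.
  intros HS Hl. induction Hl as [|c l Hc _ IH]; intros out a11 Hlen HQ.
  - apply wp_nil. rewrite app_nil_r in HQ. apply HQ.
  - cbn [length] in *. replace (3 * Datatypes.S (length l)) with (3 + 3 * length l) by lia.
    cbn [emit flat_map emit_reg app].
    instr_step; [exact Hc|]. instr_step; [exact Logic.I|].
    instr_step; [lia|]. rewrite memory_emit by lia.
    replace (length out + 1) with (length (out ++ [c])) by (rewrite length_app; auto).
    apply IH.
    + rewrite length_app; simpl; lia.
    + intros x. rewrite <- app_assoc. apply HQ.
Qed.

Lemma table_high H N lo a i : lo <= H -> 4 * H <= i -> table H N lo a i = 0.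
Proof.
  intros Hlo Hi. destruct (literal_cover i) as (x & s & ->). unfold table.
  rewrite literal_div2. cbv zeta. unfold encode_literal in Hi; cbn [fst snd] in Hi.
  destruct (Nat.leb_spec lo x), (Nat.ltb_spec x (lo + H)); auto.
  destruct s; lia.
Qed.

Definition clauses_output (neg : bool) (cpre cpost : list nat) (F : cnf)
    (T : nat -> nat) : list nat :=
  flat_map (fun cl => cpre ++ [if neg then 1 - unsat T cl else unsat T cl] ++ cpost) F.

(** What a pass still has to write when its counter is [m]. The counter runs down, hence the
    reversed order, which [vectors] shares. *)
Definition pass_output (H N : nat) (F : cnf) (lo_half neg : bool)
    (pre cpre cpost post : list nat) (m : nat) : list nat :=
  flat_map (fun a => pre ++ clauses_output neg cpre cpost F
                       (table H N (if lo_half then 0 else H) a) ++ post)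
    (rev (seq 0 m)).

Lemma length_code_universal m : length (code_universal m) = 12 * m.
Proof.
  unfold code_universal. induction m as [|m IH]; [reflexivity|].
  cbn [repeat concat]. rewrite length_app, IH. simpl. lia.
Qed.

(** Together with [finish] it restores what [initial] promises to the next program: the [len] cells
    of the input copy and the [4 * H] cells of the table become 0, register 0 gets the length of the
    output, and all other registers become 0. *)
Definition clear : cmd :=
  Seq (Blk [IAdd 15 7 10; IAdd 12 4 4; IAdd 12 12 12; IAdd 12 12 0])
      (For 12 (Blk [IStore 15 10; IAdd 15 15 one])).

Definition finish : cmd :=
  Blk (IAdd 0 9 10 :: map (fun i => IConst i 0) (seq 1 19)).

Definition vectors (H lo : nat) (F : cnf) : list (list nat) :=
  map (fun a => unsats (table H (2 ^ H) lo a) F) (rev (seq 0 (2 ^ H))).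

Lemma vectors_binary H lo F :
  Forall (fun u => length u = length F /\ binary u) (vectors H lo F).
Proof.
  unfold vectors. apply Forall_map, Forall_forall. intros a _. apply unsats_binary.
Qed.

Lemma length_vectors H lo F : length (vectors H lo F) = 2 ^ H.
Proof. unfold vectors. rewrite length_map, length_rev, length_seq. reflexivity. Qed.

Lemma pass_output_A H F :
  pass_output H (2 ^ H) F true false [3; 1; 0; 3; 0; 2] [0] [] [3; 1; 0; 4] (2 ^ H)
  = flat_map code_ablock (vectors H 0 F).
Proof.
  unfold pass_output, vectors. rewrite flat_map_map. apply flat_map_ext. intros a.
  unfold code_ablock, clauses_output, unsats. rewrite flat_map_map. reflexivity.
Qed.

Lemma pass_output_B H F :
  pass_output H (2 ^ H) F false true [2; 3; 0; 2; 0; 3; 0; 4] [2; 4; 0; 0; 0]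
    [0; 3; 0; 4] [] (2 ^ H)
  = flat_map code_bblock (vectors H H F).
Proof.
  unfold pass_output, vectors. rewrite flat_map_map. apply flat_map_ext. intros a.
  unfold code_bblock, clauses_output, unsats. rewrite flat_map_map. reflexivity.
Qed.

Lemma length_code_ablocks H F :
  length (flat_map code_ablock (vectors H 0 F)) = 2 ^ H * (2 * length F + 10).
Proof.
  rewrite <- (length_vectors H 0 F). apply length_flat_map_const.
  eapply Forall_impl; [|apply vectors_binary]. intros u [Hu _].
  unfold code_ablock. rewrite !length_app, (length_flat_map_const _ _ 2).
  - simpl. lia.
  - apply Forall_forall; auto.
Qed.

Lemma length_code_bblocks H F :
  length (flat_map code_bblock (vectors H H F)) = 2 ^ H * (10 * length F + 8).
Proof.
  rewrite <- (length_vectors H H F). apply length_flat_map_const.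
  eapply Forall_impl; [|apply vectors_binary]. intros u [Hu _].
  unfold code_bblock. rewrite !length_app, (length_flat_map_const _ _ 10).
  - simpl. lia.
  - apply Forall_forall; auto.
Qed.

(** Registers 10 and 1, holding 0 and 1, are the addresses of the two head numbers of the input. The
    first loop halves: each round swaps registers 4 and 13 while adding 1, so that after [v] rounds
    they hold [v / 2] rounded up and down. Then [N] arises by [H] doublings, [L] by adding [d + 3]
    in [N] rounds, and [S = 64 * L + len] by six doublings and one addition. *)
Definition setup : cmd :=
  Seq (Blk [IConst 1 1; ILoad 2 10; ILoad 3 1])
  (Seq (For 2 (Blk [IAdd 14 13 one; IAdd 13 4 10; IAdd 4 14 10]))
  (Seq (Blk [IConst 5 1; IAdd 12 4 10])
  (Seq (For 12 (Blk [IAdd 5 5 5]))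
  (Seq (Blk [IConst 11 3; IAdd 13 3 11; IAdd 12 5 10])
  (Seq (For 12 (Blk [IAdd 6 6 13]))
       (Blk [IAdd 7 6 6; IAdd 7 7 7; IAdd 7 7 7; IAdd 7 7 7; IAdd 7 7 7;
             IAdd 7 7 7; IAdd 7 7 0; IAdd 8 7 0])))))).

(** Each input cell is zeroed once copied: the output will grow from address 0, and the cells
    between its end and [S] must be 0. *)
Definition copy : cmd :=
  Seq (Blk [IAdd 15 7 10; IConst 16 0; IAdd 12 0 10])
      (For 12 (Blk [ILoad 11 16; IStore 15 11; IStore 16 10;
                    IAdd 15 15 one; IAdd 16 16 one])).

Definition write_A : cmd :=
  Seq (Blk (emit [1] ++ emit_reg 6))
      (pass true false [3; 1; 0; 3; 0; 2] [0] [] [3; 1; 0; 4]).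

(** The arity [2 * L + 2 + N * (d + 1)] of the root is computed as [3 * L + 2 - 2 * N], which is the
    same as [L = N * (d + 3)] and takes only additions and subtractions. *)
Definition write_B : cmd :=
  Seq (Blk (emit [1]
    ++ [IAdd 18 6 6; IAdd 18 18 6; IConst 11 2; IAdd 18 18 11; ISub 18 18 5; ISub 18 18 5]
    ++ emit_reg 18))
  (Seq emit_universal
  (Seq (Blk (emit [0; 3]))
  (Seq (pass false true [2; 3; 0; 2; 0; 3; 0; 4] [2; 4; 0; 0; 0] [0; 3; 0; 4] [])
  (Seq (Blk (emit [0; 4]))
       emit_universal)))).

Definition reduction : cmd :=
  Seq setup (Seq copy (Seq write_A (Seq write_B (Seq clear finish)))).

(** * Execution of the reduction *)

Section Reduction.

Context (V S n d H N L k : nat) (F : cnf).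

Let inp := encode_cnf n F.
Let len := length inp.

Context (Hd : d = length F) (Hn : n <= 2 * H) (HF : is_kcnf k n F)
  (HV : 64 + S + len + 4 * H + 2 * N + 4 * L + d <= V).

Notation regs o x11 x12 x13 x14 x15 x16 x17 x18 x19 :=
  [len; 1; 0; d; H; N; L; S; S + len; o; 0; x11; x12; x13; x14; x15; x16; x17; x18; x19].

(** The invariant splits the input at the read pointer and says that folding over the unread
    literals [c], from the current value [u], gives the result of the whole clause. *)
Lemma wp_literals T out x11 x12 x13 x16 x17 x19 cl rest (Q : state -> Prop) :
  Forall (fun l => fst l < n) cl ->
  forall pre u,
  inp = pre ++ map encode_literal cl ++ rest ->
  (forall x, Q (regs (length out) x11 x12 x13 0 (S + length (pre ++ map encode_literal cl))
     x x17 (fold_left (fun u l => u - T (encode_literal l)) cl u) x19, memory S inp out T)) ->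
  wp V (For 14 (Blk [ILoad 16 15; IAdd 15 15 one; IAdd 16 16 8; ILoad 16 16;
                       ISub 18 18 16])) (2 + length cl * 7) Q
    (regs (length out) x11 x12 x13 (length cl) (S + length pre) x16 x17 u x19,
     memory S inp out T).
Proof.
  intros Hcl pre0 u0 Einp HQ.
  apply (wp_for_invariant _ _ _ 5 (fun m s => exists pre c x u,
    inp = pre ++ map encode_literal c ++ rest /\ length c = m /\
    Forall (fun l => fst l < n) c /\
    pre ++ map encode_literal c = pre0 ++ map encode_literal cl /\
    fold_left (fun u l => u - T (encode_literal l)) c u
      = fold_left (fun u l => u - T (encode_literal l)) cl u0 /\
    s = (regs (length out) x11 x12 x13 m (S + length pre) x x17 u x19,
         memory S inp out T)) (length cl)).
  - exists pre0, cl, x16, u0. repeat split; auto.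
  - intros m s (pre & c & x & u & _ & _ & _ & _ & _ & ->). auto.
  - intros m s (pre & c & x & u & E & Hm & Hc & Epre & Eu & ->).
    destruct c as [|l c]; [discriminate|]. injection Hm as Hm.
    apply Forall_cons_iff in Hc. destruct Hc as [Hl Hc]. cbn [map] in E, Epre.
    assert (Hlen : length pre < len).
    { unfold len. rewrite E, length_app. simpl. lia. }
    instr_step; [exact Logic.I|].
    replace (memory S inp out T (S + length pre)) with (encode_literal l)
      by (rewrite E; symmetry; apply memory_input).
    assert (Hb : encode_literal l < 4 * H).
    { unfold encode_literal. destruct (snd l); lia. }
    instr_step; [lia|]. instr_step; [lia|].
    rewrite (Nat.add_comm (encode_literal l)). unfold len at 3.
    instr_step; [exact Logic.I|].
    rewrite memory_table.
    instr_step; [exact Logic.I|]. apply wp_nil.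
    cbn [step set_reg nth fst snd one].
    exists (pre ++ [encode_literal l]), c, (T (encode_literal l)),
      (u - T (encode_literal l)).
    rewrite <- !app_assoc. repeat split; auto.
    rewrite length_app, Nat.add_assoc, Nat.sub_succ, Nat.sub_0_r. reflexivity.
  - lia.
  - intros s (pre & c & x & u & _ & Hm & _ & Epre & Eu & ->).
    destruct c; [|discriminate]. simpl in Eu, Epre. rewrite app_nil_r in Epre.
    subst pre u. apply HQ.
Qed.

Lemma wp_clauses neg cpre cpost T out x11 x12 x13 x14 x15 x16 x17 x18 x19
    (Q : state -> Prop) :
  Forall (fun c => c <= V) cpre -> Forall (fun c => c <= V) cpost ->
  let out' := out ++ clauses_output neg cpre cpost F T in
  length out' <= S ->
  (forall x11 x13 x14 x15 x16 x17 x18 x19,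
     Q (regs (length out') x11 x12 x13 x14 x15 x16 x17 x18 x19, memory S inp out' T)) ->
  wp V (clauses neg cpre cpost)
    (5 + d * (10 + 7 * k + 3 * length cpre + 3 * length cpost)) Q
    (regs (length out) x11 x12 x13 x14 x15 x16 x17 x18 x19, memory S inp out T).
Proof.
  intros Hpre Hpost out' Hout' HQ. unfold clauses.
  apply (wp_seq_le _ _ _ 3
    (2 + d * (10 + 7 * k + 3 * length cpre + 3 * length cpost))); [|lia].
   instr_step; [lia|]. instr_step; [lia|]. instr_step; [lia|]. apply wp_nil.
    rewrite Nat.add_0_r.
    apply (wp_for_invariant _ _ _ (8 + 7 * k + 3 * length cpre + 3 * length cpost)
      (fun m s => exists pre cs o x11 x14 x16 x17 x18 x19,
        inp = pre ++ flat_map encode_clause cs /\ length cs = m /\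
        (forall cl, In cl cs -> length cl <= k /\ forall l, In l cl -> fst l < n) /\
        o ++ clauses_output neg cpre cpost cs T = out' /\
        s = (regs (length o) x11 x12 m x14 (S + length pre) x16 x17 x18 x19,
             memory S inp o T)) d).
    - exists [n; length F], F, out. do 6 eexists. repeat split; auto.
      + apply (proj2 HF cl); auto.
      + apply (proj2 HF cl); auto.
    - intros m s (pre & cs & o & y11 & y14 & y16 & y17 & y18 & y19 & _ & _ & _ & _ & ->).
      auto.
    - intros m s (pre & cs & o & y11 & y14 & y16 & y17 & y18 & y19 & E & Hm & Hcs & Eo & ->).
      destruct cs as [|cl cs]; [discriminate|]. injection Hm as Hm.
      destruct (Hcs cl (or_introl eq_refl)) as [Hk Hcl].
      assert (Hlen : length pre < len).
      { unfold len. rewrite E, length_app. simpl. lia. }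
      apply (wp_seq_le _ _ _ 3 (5 + 7 * k + 3 * length cpre + 3 * length cpost)); [|lia].
      instr_step; [exact Logic.I|].
      replace (memory S inp o T (S + length pre)) with (length cl)
        by (rewrite E; symmetry; apply memory_input).
      instr_step; [lia|]. instr_step; [lia|]. apply wp_nil.
      apply (wp_seq_le _ _ _ (2 + length cl * 7) (3 + 3 * length cpre + 3 * length cpost));
        [|nia].
      assert (E' : inp = (pre ++ [length cl]) ++ map encode_literal cl
                            ++ flat_map encode_clause cs).
      { rewrite E. cbn [flat_map encode_clause]. rewrite <- !app_assoc. reflexivity. }
      replace (S + length pre + 1) with (S + length (pre ++ [length cl]))
        by (rewrite length_app; simpl; lia).
      apply wp_literals with (rest := flat_map encode_clause cs); auto.
      { apply Forall_forall; auto. }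
      intros x. fold (unsat T cl).
      unfold clauses_output in Eo. cbn [flat_map] in Eo. rewrite <- !app_assoc in Eo.
      assert (Hlo : length o + length cpre + 1 + length cpost <= S).
      { rewrite <- Eo in Hout'. rewrite !length_app in Hout'. simpl in Hout'. lia. }
      cbn [app].
      replace (3 + 3 * length cpre + 3 * length cpost)
        with (Datatypes.S (3 * length cpre + (2 + 3 * length cpost))) by lia.
      pose proof (unsat_le_1 T cl) as Hu.
      instr_step; [exact Logic.I|].
      apply wp_app. apply wp_emit; auto; [lia|lia|]. intros z11.
      apply (wp_app _ _ _ 2).
      assert (Hsel : forall Q' : state -> Prop,
        Q' (regs (length (o ++ cpre ++ [if neg then 1 - unsat T cl else unsat T cl])) z11 x12
              (Datatypes.S m) 0
              (S + length ((pre ++ [length cl]) ++ map encode_literal cl)) x y17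
              (unsat T cl) (1 - unsat T cl),
            memory S inp (o ++ cpre ++ [if neg then 1 - unsat T cl else unsat T cl]) T) ->
        wp V (Blk (emit_reg (if neg then 19 else 18))) 2 Q'
          (regs (length (o ++ cpre)) z11 x12 (Datatypes.S m) 0
              (S + length ((pre ++ [length cl]) ++ map encode_literal cl)) x y17
              (unsat T cl) (1 - unsat T cl), memory S inp (o ++ cpre) T)).
      { intros Q' HQ'. rewrite app_assoc in HQ'. destruct neg; unfold emit_reg;
        (instr_step; [exact Logic.I|]; instr_step; [rewrite length_app; lia|];
         apply wp_nil; rewrite memory_emit by (rewrite length_app; lia);
         rewrite length_app in HQ'; exact HQ'). }
      apply Hsel. clear Hsel.
      apply wp_emit; auto; [lia|rewrite !length_app; simpl; lia|]. intros w11.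
      cbn [step set_reg nth fst snd one]. rewrite Nat.sub_succ, Nat.sub_0_r.
      exists ((pre ++ [length cl]) ++ map encode_literal cl), cs.
      eexists. do 6 eexists. split; [|split; [|split; [|split; [|reflexivity]]]].
      + rewrite <- app_assoc. exact E'.
      + exact Hm.
      + intros c Hc. apply Hcs. right; exact Hc.
      + rewrite <- Eo, <- !app_assoc. reflexivity.
    - apply Nat.add_le_mono_l, Nat.mul_le_mono_l. lia.
    - intros s (pre & cs & o & y11 & y14 & y16 & y17 & y18 & y19 & _ & Hm & _ & Eo & ->).
      destruct cs; [|discriminate]. unfold clauses_output in Eo. simpl in Eo.
      rewrite app_nil_r in Eo. subst o.
      apply HQ.
Qed.

Lemma wp_decode (lo_half : bool) T out x11 a x13 x14 x15 x16 x17 x18 x19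
    (Q : state -> Prop) :
  N = 2 ^ H -> a < N ->
  (forall i, 4 * H <= i -> T i = 0) ->
  (forall x13 x14 x15 x16 x17 x18 x19,
     Q (regs (length out) x11 (Datatypes.S a) x13 x14 x15 x16 x17 x18 x19,
        memory S inp out (table H N (if lo_half then 0 else H) a))) ->
  wp V (decode lo_half) (7 + H * 21) Q
    (regs (length out) x11 (Datatypes.S a) x13 x14 x15 x16 x17 x18 x19,
     memory S inp out T).
Proof.
  intros HN Ha HT HQ. unfold decode.
  set (lo := if lo_half then 0 else H) in *.
  set (lo' := if lo_half then H else 0).
  assert (Hlo : lo = 0 /\ lo' = H \/ lo = H /\ lo' = 0)
    by (unfold lo, lo'; destruct lo_half; auto).
  apply (wp_seq_le _ _ _ 5 (2 + H * 21)); [|lia].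
  apply (wp_weaken _ _ 5 _ (fun s => s =
    (regs (length out) x11 (Datatypes.S a) H x14 (S + len + 2 * lo) (S + len + 2 * lo')
       a x18 x19, memory S inp out T))); [|lia|].
  { unfold lo, lo'. destruct lo_half.
    - instr_step; [lia|]. instr_step; [lia|]. instr_step; [lia|].
      instr_step; [exact Logic.I|]. instr_step; [lia|]. apply wp_nil.
      rewrite Nat.sub_succ, Nat.sub_0_r.
      same_state.
    - instr_step; [lia|]. instr_step; [lia|]. instr_step; [lia|].
      instr_step; [exact Logic.I|]. instr_step; [lia|]. apply wp_nil.
      rewrite Nat.sub_succ, Nat.sub_0_r.
      same_state. }
  intros s' ->.
  apply (wp_for_invariant _ _ _ 19 (fun m s => exists v x14 x18 x19,
    v + m = H /\ s = (regs (length out) x11 (Datatypes.S a) m x14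
        (S + len + 2 * (lo + v)) (S + len + 2 * (lo' + v))
        (residue N a v) x18 x19,
      memory S inp out (partial_table H N lo lo' a v T))) H).
  - exists 0, x14, x18, x19. split; auto. rewrite partial_table_0, !Nat.add_0_r.
    reflexivity.
  - intros m s (v & y14 & y18 & y19 & _ & ->). auto.
  - intros m s (v & y14 & y18 & y19 & Hv & ->).
    pose proof (residue_lt N a v Ha) as Hr.
    pose proof (digit_le N a v) as Hd1.
    apply (wp_seq_le _ _ _ 6 13); [|lia].
    instr_step; [lia|]. instr_step; [lia|]. instr_step; [exact Logic.I|].
    instr_step; [exact Logic.I|]. instr_step; [exact Logic.I|].
    replace (residue N a v + residue N a v) with (2 * residue N a v) by lia.
    replace (1 - (2 * residue N a v + 1 - N)) with (1 - digit N a v)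
      by (unfold digit; destruct (Nat.leb_spec N (2 * residue N a v)); lia).
    replace (1 - (1 - digit N a v)) with (digit N a v) by lia.
    instr_step; [lia|]. apply wp_nil. rewrite Nat.add_0_r.
    apply (wp_seq_le _ _ _ 5 8); [|lia].
    apply (wp_for_invariant _ _ _ 1 (fun c s =>
      s = (regs (length out) x11 (Datatypes.S a) (Datatypes.S m) c
        (S + len + 2 * (lo + v)) (S + len + 2 * (lo' + v))
        (2 * residue N a v - (digit N a v - c) * N)
        (1 - digit N a v) (digit N a v),
      memory S inp out (partial_table H N lo lo' a v T)) /\ c <= digit N a v)
      (digit N a v)).
    { split; auto. rewrite Nat.sub_diag, Nat.sub_0_r. reflexivity. }
    { intros c s [-> _]; auto. }
    { intros c s [-> Hc]. instr_step; [exact Logic.I|]. apply wp_nil.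
      cbn [step set_reg nth fst snd one]. split; [|lia].
      rewrite Nat.sub_succ, Nat.sub_0_r. same_state. }
    { lia. }
    intros s [-> _]. rewrite Nat.sub_0_r, <- residue_S.
    unfold len.
    instr_step; [exact Logic.I|]. rewrite memory_set_table. fold len.
    instr_step; [lia|].
    replace (S + len + 2 * (lo + v) + 1) with (S + len + (2 * (lo + v) + 1)) by lia.
    unfold len.
    instr_step; [exact Logic.I|]. rewrite memory_set_table. fold len.
    instr_step; [lia|].
    instr_step; [exact Logic.I|]. unfold len. rewrite memory_set_table. fold len.
    instr_step; [lia|].
    replace (S + len + 2 * (lo' + v) + 1) with (S + len + (2 * (lo' + v) + 1)) by lia.
    instr_step; [exact Logic.I|]. unfold len. rewrite memory_set_table. fold len.
    instr_step; [lia|]. apply wp_nil.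
    rewrite partial_table_S by (auto; lia).
    cbn [step set_reg nth fst snd one].
    exists (Datatypes.S v), 0, (1 - digit N a v), (digit N a v). split; [lia|].
    rewrite Nat.sub_succ, Nat.sub_0_r. unfold len. same_state.
  - lia.
  - intros s (v & y14 & y18 & y19 & Hv & ->).
    replace v with H by lia. rewrite partial_table_full by auto. apply HQ.
Qed.

(** Of the table left by the previous round only the zeros from [4 * H] on matter, since [decode]
    rewrites all entries below. *)
Lemma wp_pass lo_half neg pre cpre cpost post T out x11 x12 x13 x14 x15 x16 x17 x18 x19
    (Q : state -> Prop) :
  N = 2 ^ H ->
  Forall (fun c => c <= V) pre -> Forall (fun c => c <= V) cpre ->
  Forall (fun c => c <= V) cpost -> Forall (fun c => c <= V) post ->
  let out' := out ++ pass_output H N F lo_half neg pre cpre cpost post N in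
  length out' <= S ->
  (forall i, 4 * H <= i -> T i = 0) ->
  (forall T' x11 x12 x13 x14 x15 x16 x17 x18 x19,
     (forall i, 4 * H <= i -> T' i = 0) ->
     Q (regs (length out') x11 x12 x13 x14 x15 x16 x17 x18 x19,
        memory S inp out' T')) ->
  wp V (pass lo_half neg pre cpre cpost post)
    (3 + N * (14 + 21 * H + d * (10 + 7 * k + 3 * length cpre + 3 * length cpost)
                 + 3 * length pre + 3 * length post)) Q
    (regs (length out) x11 x12 x13 x14 x15 x16 x17 x18 x19, memory S inp out T).
Proof.
  intros HN Hpre Hcpre Hcpost Hpost out' Hout' HT HQ. unfold pass.
  set (tc := 5 + d * (10 + 7 * k + 3 * length cpre + 3 * length cpost)).
  set (tb := 3 * length pre + (7 + H * 21 + (tc + 3 * length post))).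
  apply (wp_seq_le _ _ _ 1 (2 + N * (tb + 2))); [|unfold tb, tc; nia].
  instr_step; [lia|]. apply wp_nil. rewrite Nat.add_0_r.
  apply (wp_for_invariant _ _ _ tb (fun m s => exists o T x11 x13 x14 x15 x16 x17 x18 x19,
    o ++ pass_output H N F lo_half neg pre cpre cpost post m = out' /\
    m <= N /\ (forall i, 4 * H <= i -> T i = 0) /\
    s = (regs (length o) x11 m x13 x14 x15 x16 x17 x18 x19, memory S inp o T)) N).
  - exists out, T. do 8 eexists. repeat split; auto.
  - intros m s (o & T' & y11 & y13 & y14 & y15 & y16 & y17 & y18 & y19 & _ & _ & _ & ->).
    auto.
  - intros m s (o & T' & y11 & y13 & y14 & y15 & y16 & y17 & y18 & y19 & Eo & Hm & HT' & ->).
    (* With the counter at [m + 1] the assignment in hand is [m], the first of the reversed list. *)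
    unfold pass_output in Eo. rewrite seq_S, rev_app_distr in Eo.
    cbn [rev app flat_map] in Eo. rewrite Nat.add_0_l in Eo.
    change (flat_map _ (rev (seq 0 m)))
      with (pass_output H N F lo_half neg pre cpre cpost post m) in Eo.
    set (co := clauses_output neg cpre cpost F (table H N (if lo_half then 0 else H) m)) in *.
    rewrite <- !app_assoc in Eo.
    assert (Hlo : length o + length pre + length co + length post <= S).
    { rewrite <- Eo in Hout'. rewrite !length_app in Hout'. lia. }
    apply wp_seq. apply wp_emit; auto; [lia|lia|]. intros z11.
    apply wp_seq. apply wp_decode; auto. intros.
    apply wp_seq. apply wp_clauses; auto.
    { fold co. rewrite !length_app. lia. }
    fold co. intros. apply wp_emit; auto; [lia|rewrite !length_app; lia|]. intros w11.
    cbn [step set_reg nth fst snd one]. rewrite Nat.sub_succ, Nat.sub_0_r.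
    do 2 eexists. do 8 eexists. split; [|split; [|split; [|reflexivity]]].
    + rewrite <- Eo, <- !app_assoc. reflexivity.
    + lia.
    + intros i Hi. apply table_high; auto. destruct lo_half; lia.
  - lia.
  - intros s (o & T' & y11 & y13 & y14 & y15 & y16 & y17 & y18 & y19 & Eo & _ & HT' & ->).
    unfold pass_output in Eo; simpl in Eo. rewrite app_nil_r in Eo. subst o.
    apply HQ; auto.
Qed.

Lemma wp_universal T out x11 x12 x13 x14 x15 x16 x17 x18 x19 (Q : state -> Prop) :
  let out' := out ++ code_universal L in
  length out' <= S ->
  (forall x11 x12, Q (regs (length out') x11 x12 x13 x14 x15 x16 x17 x18 x19,
        memory S inp out' T)) ->
  wp V emit_universal (3 + L * 38) Q
    (regs (length out) x11 x12 x13 x14 x15 x16 x17 x18 x19, memory S inp out T).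
Proof.
  intros out' Hout' HQ. unfold emit_universal.
  apply (wp_seq_le _ _ _ 1 (2 + L * 38)); [|lia].
  instr_step; [lia|]. apply wp_nil. rewrite Nat.add_0_r.
  apply (wp_for_invariant _ _ _ 36 (fun m s => exists o x11,
    o ++ code_universal m = out' /\
    s = (regs (length o) x11 m x13 x14 x15 x16 x17 x18 x19, memory S inp o T)) L).
  - exists out, x11. auto.
  - intros m s (o & y11 & _ & ->). auto.
  - intros m s (o & y11 & Eo & ->).
    assert (Hlo : length o + 12 <= S).
    { rewrite <- Eo in Hout'. rewrite !length_app, length_code_universal in Hout'. lia. }
    apply (wp_emit V S inp _ _ _ _ _ _ _ _ _ _ _ universal_letter_code); auto; try lia.
    { unfold universal_letter_code. repeat (apply Forall_cons; [lia|]). apply Forall_nil. }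
    intros z11. cbn [step set_reg nth fst snd one]. rewrite Nat.sub_succ, Nat.sub_0_r.
    do 2 eexists. split; [|reflexivity].
    rewrite <- Eo, <- app_assoc. reflexivity.
  - lia.
  - intros s (o & y11 & Eo & ->). unfold code_universal in Eo. simpl in Eo.
    rewrite app_nil_r in Eo. subst o. apply HQ.
Qed.

Lemma wp_clear T out x11 x12 x13 x14 x15 x16 x17 x18 x19 (Q : state -> Prop) :
  length out <= S -> (forall i, 4 * H <= i -> T i = 0) ->
  (forall x12 x15, Q (regs (length out) x11 x12 x13 x14 x15 x16 x17 x18 x19,
      fun i => nth i out 0)) ->
  wp V clear (6 + (len + 4 * H) * 4) Q
    (regs (length out) x11 x12 x13 x14 x15 x16 x17 x18 x19, memory S inp out T).
Proof.
  intros Hout HT HQ. unfold clear.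
  apply (wp_seq_le _ _ _ 4 (2 + (len + 4 * H) * 4)); [|lia].
  instr_step; [lia|]. instr_step; [lia|]. instr_step; [lia|]. instr_step; [lia|].
  apply wp_nil.
  replace (H + H + (H + H) + len) with (len + 4 * H) by lia. rewrite Nat.add_0_r.
  apply (wp_for_invariant _ _ _ 2 (fun m s => exists v, v + m = len + 4 * H /\
    s = (regs (length out) x11 m x13 x14 (S + v) x16 x17 x18 x19,
         fun i => if (S <=? i) && (i <? S + v) then 0 else memory S inp out T i))
    (len + 4 * H)).
  - exists 0. split; auto. rewrite Nat.add_0_r. f_equal.
    apply functional_extensionality. intros i.
    destruct (Nat.leb_spec S i), (Nat.ltb_spec i S); auto; lia.
  - intros m s (v & _ & ->). auto.
  - intros m s (v & Hv & ->).
    instr_step; [exact Logic.I|]. instr_step; [lia|]. apply wp_nil.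
    cbn [step set_reg nth fst snd one]. exists (Datatypes.S v). split; [lia|].
    apply (f_equal2 pair).
    + rewrite Nat.sub_succ, Nat.sub_0_r.
      repeat (apply (f_equal2 cons); [first [reflexivity | lia] |]); reflexivity.
    + apply functional_extensionality. intros i. unfold set_mem, update.
      destruct (Nat.eqb_spec i (S + v));
      destruct (Nat.leb_spec S i), (Nat.ltb_spec i (S + v)),
        (Nat.ltb_spec i (S + Datatypes.S v)); cbn [andb]; auto; try lia.
  - lia.
  - intros s (v & Hv & ->).
    replace (fun i => if (S <=? i) && (i <? S + v) then 0 else memory S inp out T i)
      with (fun i => nth i out 0); [apply HQ|].
    apply functional_extensionality. intros i. unfold memory. fold len.
    destruct (Nat.leb_spec S i), (Nat.ltb_spec i (S + v)), (Nat.ltb_spec i S);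
      cbn [andb]; auto; try lia.
    + apply nth_overflow; lia.
    + destruct (Nat.ltb_spec i (S + len)); [lia|].
      rewrite HT by lia. apply nth_overflow; lia.
Qed.

Lemma wp_setup (Q : state -> Prop) :
  H = (n + 1) / 2 -> N = 2 ^ H -> L = N * (d + 3) -> S = 64 * L + len ->
  (forall x11 x12 x13 x14,
     Q (regs 0 x11 x12 x13 x14 0 0 0 0 0, fun i => nth i inp 0)) ->
  wp V setup (32 + n * 5 + H * 3 + N * 3) Q
    (len :: repeat 0 19, fun i => nth i inp 0).
Proof.
  intros HH HN HL HS HQ. unfold setup. cbn [repeat].
  apply (wp_seq_le _ _ _ 3 (29 + n * 5 + H * 3 + N * 3)); [|lia].
  instr_step; [lia|]. instr_step; [exact Logic.I|]. instr_step; [exact Logic.I|].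
  apply wp_nil.
  change (nth 0 inp 0) with n.
  change (nth 1 inp 0) with (length F). rewrite <- Hd.
  apply (wp_seq_le _ _ _ (2 + n * 5) (27 + H * 3 + N * 3)); [|lia].
  apply (wp_for_invariant _ _ _ 3 (fun m s => exists v x14, v + m = n /\
    s = ([len; 1; m; d; (v + 1) / 2; 0; 0; 0; 0; 0; 0; 0; 0; v / 2; x14; 0; 0; 0; 0; 0],
         fun i => nth i inp 0)) n).
  { exists 0, 0. auto. }
  { intros m s (v & y & _ & ->). auto. }
  { intros m s (v & y & Hv & ->).
    pose proof (Nat.Div0.div_le_mono (v + 1) (n + 1) 2).
    pose proof (Nat.Div0.div_le_mono v (n + 1) 2).
    instr_step; [lia|]. instr_step; [lia|]. instr_step; [lia|]. apply wp_nil.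
    cbn [step set_reg nth fst snd one]. exists (Datatypes.S v), (v / 2 + 1).
    split; [lia|]. rewrite Nat.sub_succ, !Nat.sub_0_r, !Nat.add_0_r.
    replace (Datatypes.S v + 1) with (v + 1 * 2) by lia.
    rewrite Nat.div_add by lia. rewrite (Nat.add_1_r v). reflexivity. }
  { lia. }
  intros s (v & y & Hv & ->). rewrite Nat.add_0_r in Hv. subst v. rewrite <- HH.
  apply (wp_seq_le _ _ _ 2 (25 + H * 3 + N * 3)); [|lia].
  instr_step; [lia|]. instr_step; [lia|]. apply wp_nil. rewrite Nat.add_0_r.
  apply (wp_seq_le _ _ _ (2 + H * 3) (23 + N * 3)); [|lia].
  apply (wp_for_invariant _ _ _ 1 (fun m s => exists v, v + m = H /\
    s = ([len; 1; 0; d; H; 2 ^ v; 0; 0; 0; 0; 0; 0; m; n / 2; y; 0; 0; 0; 0; 0],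
         fun i => nth i inp 0)) H).
  { exists 0. auto. }
  { intros m s (v & _ & ->). auto. }
  { intros m s (v & Hv & ->).
    assert (Hp : 2 ^ Datatypes.S v <= N) by (rewrite HN; apply Nat.pow_le_mono_r; lia).
    rewrite Nat.pow_succ_r' in Hp.
    instr_step; [lia|]. apply wp_nil. cbn [step set_reg nth fst snd one].
    exists (Datatypes.S v). split; [lia|].
    rewrite Nat.sub_succ, Nat.sub_0_r, Nat.pow_succ_r'. same_state. }
  { lia. }
  intros s (v & Hv & ->). rewrite Nat.add_0_r in Hv. subst v. rewrite <- HN.
  apply (wp_seq_le _ _ _ 3 (20 + N * 3)); [|lia].
  instr_step; [lia|]. instr_step; [lia|]. instr_step; [lia|]. apply wp_nil.
  rewrite Nat.add_0_r.
  apply (wp_seq_le _ _ _ (2 + N * 3) 8); [|lia].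
  apply (wp_for_invariant _ _ _ 1 (fun m s => exists v, v + m = N /\
    s = ([len; 1; 0; d; H; N; v * (d + 3); 0; 0; 0; 0; 3; m; d + 3; y; 0; 0; 0; 0; 0],
         fun i => nth i inp 0)) N).
  { exists 0. auto. }
  { intros m s (v & _ & ->). auto. }
  { intros m s (v & Hv & ->).
    assert (Hp : Datatypes.S v * (d + 3) <= L) by (rewrite HL; apply Nat.mul_le_mono_r; lia).
    instr_step; [lia|]. apply wp_nil. cbn [step set_reg nth fst snd one].
    exists (Datatypes.S v). split; [lia|].
    rewrite Nat.sub_succ, Nat.sub_0_r. same_state. }
  { lia. }
  intros s (v & Hv & ->). rewrite Nat.add_0_r in Hv. subst v. rewrite <- HL.
  do 8 (instr_step; [lia|]). apply wp_nil.
  match goal with |- Q ([_; _; _; _; _; _; _; ?a; _; _; _; _; _; _; _; _; _; _; _; _], _) =>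
    replace a with S by lia end.
  apply HQ.
Qed.

Lemma wp_copy x11 x12 x13 x14 x15 x16 x17 x18 x19 (Q : state -> Prop) :
  len <= S ->
  (forall x11 x12 x15 x16,
     Q (regs 0 x11 x12 x13 x14 x15 x16 x17 x18 x19, memory S inp [] (fun _ => 0))) ->
  wp V copy (5 + len * 7) Q
    (regs 0 x11 x12 x13 x14 x15 x16 x17 x18 x19, fun i => nth i inp 0).
Proof.
  intros HS HQ. unfold copy.
  apply (wp_seq_le _ _ _ 3 (2 + len * 7)); [|lia].
  instr_step; [lia|]. instr_step; [lia|]. instr_step; [lia|]. apply wp_nil.
  rewrite !Nat.add_0_r.
  (* Because of [len <= S], source and target do not overlap, and zeroing the source destroys
     nothing that was copied. *)
  apply (wp_for_invariant _ _ _ 5 (fun m s => exists v x11, v + m = len /\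
    s = (regs 0 x11 m x13 x14 (S + v) v x17 x18 x19,
         fun i => if i <? v then 0 else if i <? S then nth i inp 0
                  else if i <? S + v then nth (i - S) inp 0 else 0)) len).
  - exists 0, x11. split; auto. rewrite Nat.add_0_r. f_equal.
    apply functional_extensionality. intros i. destruct (Nat.ltb_spec i 0); [lia|].
    destruct (Nat.ltb_spec i S); auto. apply nth_overflow. fold len; lia.
  - intros m s (v & y & _ & ->). auto.
  - intros m s (v & y & Hv & ->).
    instr_step; [exact Logic.I|]. instr_step; [exact Logic.I|].
    instr_step; [exact Logic.I|]. instr_step; [lia|]. instr_step; [lia|]. apply wp_nil.
    cbn [step set_reg nth fst snd one]. exists (Datatypes.S v). eexists. split; [lia|].
    rewrite Nat.sub_succ, Nat.sub_0_r, <- Nat.add_assoc, (Nat.add_1_r v).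
    apply (f_equal2 pair); [reflexivity|].
    apply functional_extensionality. intros i. unfold set_mem, update.
    destruct (Nat.ltb_spec v v), (Nat.ltb_spec v S); try lia.
    destruct (Nat.eqb_spec i v), (Nat.eqb_spec i (S + v)), (Nat.ltb_spec i v),
      (Nat.ltb_spec i (Datatypes.S v)), (Nat.ltb_spec i S), (Nat.ltb_spec i (S + v)),
      (Nat.ltb_spec i (S + Datatypes.S v)); auto; try lia.
    f_equal; lia.
  - lia.
  - intros s (v & y & Hv & ->). rewrite Nat.add_0_r in Hv. subst v.
    match goal with |- Q (_, ?f) =>
      replace f with (memory S inp [] (fun _ => 0)); [apply HQ|] end.
    apply functional_extensionality. intros i. unfold memory. fold len.
    destruct (Nat.ltb_spec i S), (Nat.ltb_spec i len), (Nat.ltb_spec i (S + len));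
      auto; try lia.
    + destruct i; auto.
    + rewrite (nth_overflow inp) by (fold len; lia). destruct i; auto.
Qed.

Lemma wp_finish o x11 x12 x13 x14 x15 x16 x17 x18 x19 M (Q : state -> Prop) :
  o <= V -> Q (o :: repeat 0 19, M) ->
  wp V finish 20 Q (regs o x11 x12 x13 x14 x15 x16 x17 x18 x19, M).
Proof.
  intros Ho HQ. unfold finish. cbn [map seq].
  instr_step; [lia|]. do 19 (instr_step; [lia|]). apply wp_nil.
  rewrite Nat.add_0_r. exact HQ.
Qed.

Lemma wp_reduction (Q : state -> Prop) :
  H = (n + 1) / 2 -> N = 2 ^ H -> L = N * (d + 3) -> S = 64 * L + len ->
  let out := encode_regexp (regA (vectors H 0 F))
               ++ encode_regexp (regB L (vectors H H F)) in
  Q (length out :: repeat 0 19, fun i => nth i out 0) ->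
  wp V reduction
    (200 + 5 * n + 20 * H + 11 * len + 76 * L + N * (90 + 42 * H + d * (60 + 14 * k))) Q
    (len :: repeat 0 19, fun i => nth i inp 0).
Proof.
  intros HH HN HL HS out HQ.
  assert (Eout : out = (([1] ++ [L]) ++ flat_map code_ablock (vectors H 0 F))
    ++ [1] ++ [3 * L + 2 - 2 * N] ++ code_universal L ++ [0; 3]
    ++ flat_map code_bblock (vectors H H F) ++ [0; 4] ++ code_universal L).
  { unfold out. rewrite (encode_regA (length F)), (encode_regB (length F))
      by apply vectors_binary.
    rewrite !length_vectors, <- HN, <- Hd, <- HL.
    replace (2 * L + 2 + N * (d + 1)) with (3 * L + 2 - 2 * N) by (rewrite HL; lia).
    reflexivity. }
  (* The output consists of [24 * L + N * (12 * d + 18) + 8] numbers, where the middle term is at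
     most [12 * L] and [3 <= L]; the 64 in [S] is a power of two that leaves room for this. *)
  assert (Hlen : length out <= S).
  { rewrite Eout, !length_app, !length_code_universal, length_code_ablocks,
      length_code_bblocks, <- HN, <- Hd. cbn [length].
    assert (1 <= N) by (rewrite HN; apply Nat.neq_0_lt_0, Nat.pow_nonzero; lia).
    rewrite HS, HL. nia. }
  clearbody out. subst out.
  rewrite !length_app, !length_code_universal in Hlen. cbn [length] in Hlen.
  (* The summands are the budgets of [setup], [copy], [write_A], [write_B], [clear] and [finish]. *)
  eapply (wp_weaken V reduction
    ((32 + n * 5 + H * 3 + N * 3) + ((5 + len * 7) + (
     ((3 * 1 + 2) + (3 + N * (14 + 21 * H + d * (10 + 7 * k + 3 * 1 + 3 * 0) + 3 * 6 + 3 * 4)))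
     + (((3 * 1 + (6 + 2)) + ((3 + L * 38) + (3 * 2 + ((3 + N * (14 + 21 * H + d * (10 + 7 * k + 3 * 5 + 3 * 4)
         + 3 * 8 + 3 * 0)) + (3 * 2 + (3 + L * 38))))))
     + ((6 + (len + 4 * H) * 4) + 20)))))); [|nia|intros s Hs; exact Hs].
  unfold reduction.
  apply wp_seq, wp_setup; auto. intros.
  apply wp_seq, wp_copy; [lia|]. intros.
  apply wp_seq. unfold write_A. apply wp_seq.
  apply wp_app.
  apply (wp_emit V S inp _ _ _ _ _ _ _ _ _ _ _ [1]) with (out := []); auto;
    [lia| |simpl; lia|].
  { repeat (apply Forall_cons; [lia|]). apply Forall_nil. }
  intros. cbn [app]. unfold emit_reg.
  instr_step; [exact Logic.I|]. instr_step; [cbn [length]; lia|]. apply wp_nil.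
  rewrite (memory_emit _ _ [1]) by (simpl; lia).
  change (length [1] + 1) with (length ([1] ++ [L])).
  apply (wp_pass true false [3; 1; 0; 3; 0; 2] [0] [] [3; 1; 0; 4]); auto;
    try (repeat (apply Forall_cons; [lia|]); apply Forall_nil).
  { rewrite HN, pass_output_A, length_app. cbn [length app]. lia. }
  rewrite HN, pass_output_A, <- HN. intros.
  apply wp_seq. unfold write_B. apply wp_seq.
  set (outA := ([1] ++ [L]) ++ flat_map code_ablock (vectors H 0 F)) in *.
  assert (HoA : length outA = 2 + length (flat_map code_ablock (vectors H 0 F))).
  { reflexivity. }
  apply wp_app.
  apply (wp_emit V S inp _ _ _ _ _ _ _ _ _ _ _ [1]); auto; [lia| |simpl; lia|].
  { repeat (apply Forall_cons; [lia|]). apply Forall_nil. }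
  intros. apply wp_app. do 6 (instr_step; [first [exact Logic.I | lia]|]). apply wp_nil.
  unfold emit_reg. instr_step; [exact Logic.I|].
  instr_step; [rewrite length_app; simpl; lia|]. apply wp_nil.
  rewrite memory_emit by (rewrite length_app; simpl; lia).
  replace (length (outA ++ [1]) + 1) with
    (length ((outA ++ [1]) ++ [L + L + L + 2 - N - N])) by (rewrite length_app; reflexivity).
  replace (L + L + L + 2 - N - N) with (3 * L + 2 - 2 * N) by lia.
  apply wp_seq, wp_universal.
  { rewrite !length_app, length_code_universal. simpl. lia. }
  intros. apply wp_seq.
  apply (wp_emit V S inp _ _ _ _ _ _ _ _ _ _ _ [0; 3]); auto; [lia| | |].
  { repeat (apply Forall_cons; [lia|]). apply Forall_nil. }
  { rewrite !length_app, length_code_universal. simpl. lia. }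
  intros. apply wp_seq.
  apply (wp_pass false true [2; 3; 0; 2; 0; 3; 0; 4] [2; 4; 0; 0; 0] [0; 3; 0; 4] []); auto;
    try (repeat (apply Forall_cons; [lia|]); apply Forall_nil).
  { rewrite HN, pass_output_B, !length_app, length_code_universal. simpl. lia. }
  rewrite HN, pass_output_B, <- HN. intros. apply wp_seq.
  apply (wp_emit V S inp _ _ _ _ _ _ _ _ _ _ _ [0; 4]); auto; [lia| | |].
  { repeat (apply Forall_cons; [lia|]). apply Forall_nil. }
  { rewrite !length_app, length_code_universal. simpl. lia. }
  intros. apply wp_universal.
  { rewrite !length_app, !length_code_universal. simpl. lia. }
  rewrite <- !app_assoc in *. intros.
  apply wp_seq, wp_clear; auto.
  { rewrite !length_app, !length_code_universal. simpl. lia. }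
  intros. apply wp_finish; [|exact HQ].
  rewrite !length_app, !length_code_universal. simpl. lia.
Qed.
End Reduction.

(** * Composition with the intersection test *)

Definition reduce_to (P : program) : program :=
  let code := compile 0 reduction in code ++ map (shift (length code)) P.

Lemma initial_conf l :
  initial l = conf 0 (length l :: repeat 0 19, fun i => nth i l 0).
Proof.
  unfold initial, conf. f_equal. apply functional_extensionality. intros i.
  unfold update. cbn [fst]. destruct i as [|i]; [reflexivity|].
  cbn [Nat.eqb nth]. rewrite nth_repeat. reflexivity.
Qed.

(** Bounds the initial memory, as [values_below] demands of the state in which the reduction
    starts. *)
Lemma in_encode_cnf k n F x :
  is_kcnf k n F -> In x (encode_cnf n F) -> x <= length (encode_cnf n F) + 2 * n.
Proof.
  intros [_ HF] Hx. unfold encode_cnf in *. destruct Hx as [<-|[<-|Hx]].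
  - lia.
  - simpl. assert (length F <= length (flat_map encode_clause F)); [|lia].
    clear. induction F as [|c F IH]; simpl; [lia|]. rewrite length_app. lia.
  - apply in_flat_map in Hx. destruct Hx as (c & Hc & [<-|Hx]).
    + apply in_split in Hc. destruct Hc as (F1 & F2 & ->).
      rewrite flat_map_app. simpl. rewrite !length_app. simpl.
      rewrite length_app, length_map. lia.
    + apply in_map_iff in Hx. destruct Hx as (l & <- & Hl).
      apply (proj2 (HF c Hc)) in Hl. unfold encode_literal. destruct (snd l); lia.
Qed.

Lemma half_bounds n : n <= 2 * ((n + 1) / 2) <= n + 1.
Proof.
  pose proof (Nat.div_mod_eq (n + 1) 2). pose proof (Nat.mod_upper_bound (n + 1) 2). lia.
Qed.

Lemma reduce_to_correct P k n F answer bound :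
  is_kcnf k n F ->
  let H := (n + 1) / 2 in
  let N := 2 ^ H in
  let d := length F in
  let L := N * (d + 3) in
  let len := length (encode_cnf n F) in
  let S := 64 * L + len in
  let V := 64 + S + len + 4 * H + 2 * N + 4 * L + d in
  let steps := 200 + 5 * n + 20 * H + 11 * len + 76 * L
                 + N * (90 + 42 * H + d * (60 + 14 * k)) in
  decides_within P (encode_regexp (regA (vectors H 0 F))
                      ++ encode_regexp (regB L (vectors H H F))) answer bound ->
  decides_within (reduce_to P) (encode_cnf n F) answer
    (INR (steps * (2 * bitlen V)) + bound)%R.
Proof.
  intros HF H N d L len S V steps (t & c & Hrun & Hans & Ht).
  set (out := encode_regexp _ ++ _) in *.
  pose proof (half_bounds n) as Hn.
  assert (Hwp := wp_reduction V S n d H N L k F eq_refl (proj1 Hn) HF (le_n V)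
    (fun s => s = (length out :: repeat 0 19, fun i => nth i out 0))
    eq_refl eq_refl eq_refl eq_refl eq_refl).
  destruct Hwp as (t' & s' & Heval & Ht' & ->).
  assert (Hb : values_below V (len :: repeat 0 19, fun i => nth i (encode_cnf n F) 0)).
  { split; cbn [fst snd]; intros i.
    - destruct i as [|i]; cbn [nth]; [unfold V; lia|]. rewrite nth_repeat. lia.
    - destruct (nth_in_or_default i (encode_cnf n F) 0) as [Hin|E]; [|lia].
      apply (in_encode_cnf k) in Hin; auto. fold len in Hin.
      fold H in Hn. unfold V, S. lia. }
  assert (EP : reduce_to P = [] ++ compile (length (@nil instr)) reduction
                 ++ map (shift (length (compile 0 reduction))) P) by reflexivity.
  destruct (compile_correct _ _ _ _ _ Heval _ _ _ EP Hb) as (_ & (t0 & Hreach & Ht0) & _).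
  cbn [length] in Hreach. rewrite Nat.add_0_l in Hreach.
  set (code := compile 0 reduction) in *.
  (* The reduction ends in the registers and memory of [initial out], with the program counter on
     the first instruction of the relocated [P]. *)
  pose proof (runs_shift _ _ _ _ Hrun code) as Hrun'.
  rewrite initial_conf in Hrun'. cbn [conf pc reg mem] in Hrun'.
  rewrite Nat.add_0_r in Hrun'.
  exists (t0 + t), (Config (length code + pc c) (reg c) (mem c)).
  split; [|split].
  - rewrite initial_conf. eapply reaches_runs; [exact Hreach|exact Hrun'].
  - exact Hans.
  - rewrite plus_INR. apply Rplus_le_compat; auto. apply le_INR.
    eapply Nat.le_trans; [exact Ht0|]. apply Nat.mul_le_mono_r. exact Ht'.
Qed.

Lemma reduction_correct k n F :
  is_kcnf k n F ->
  let H := (n + 1) / 2 in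
  let L := 2 ^ H * (length F + 3) in
  (exists w, lang (regA (vectors H 0 F)) w /\ lang (regB L (vectors H H F)) w)
  <-> satisfiable F.
Proof.
  intros HF H L.
  assert (Hmem : forall a, In a (rev (seq 0 (2 ^ H))) <-> a < 2 ^ H).
  { intros a. rewrite <- in_rev, in_seq. lia. }
  rewrite (satisfiable_iff_compatible k n F H (table H (2 ^ H) 0) (table H (2 ^ H) H));
    auto using half_table_table; [|apply half_bounds].
  split.
  - intros (w & HA & HB).
    destruct (intersection_sound (length F) _ _ _ _
      (vectors_binary _ _ _) (vectors_binary _ _ _) HA HB) as (u & v & Hu & Hv & Huv).
    unfold vectors in Hu, Hv. apply in_map_iff in Hu, Hv.
    destruct Hu as (a & <- & Ha), Hv as (b & <- & Hb).
    exists a, b. repeat split; auto; apply Hmem; auto.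
  - intros (a & b & Ha & Hb & Hab).
    apply (intersection_complete (length F) _ _ _
             (unsats (table H (2 ^ H) 0 a) F) (unsats (table H (2 ^ H) H b) F));
      auto using vectors_binary.
    + rewrite length_vectors. auto.
    + apply in_map_iff. exists a. split; [reflexivity|]. apply Hmem; auto.
    + apply in_map_iff. exists b. split; [reflexivity|]. apply Hmem; auto.
Qed.

(** * Running time *)

Fixpoint words_upto {A} (l : list A) (k : nat) : list (list A) :=
  match k with
  | 0 => [[]]
  | S k => [] :: flat_map (fun w => map (fun a => a :: w) l) (words_upto l k)
  end.

Lemma length_words_upto {A} (l : list A) k :
  length (words_upto l k) <= (length l + 1) ^ k.
Proof.
  induction k as [|k IH]; [simpl; lia|]. cbn [words_upto length].
  rewrite (length_flat_map_const _ _ (length l)).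
  - rewrite Nat.pow_succ_r'.
    assert (1 <= (length l + 1) ^ k) by (apply Nat.neq_0_lt_0, Nat.pow_nonzero; lia).
    nia.
  - apply Forall_forall. intros; apply length_map.
Qed.

Lemma in_words_upto {A} (l w : list A) k :
  length w <= k -> incl w l -> In w (words_upto l k).
Proof.
  revert k; induction w as [|a w IH]; intros k Hw Hl.
  - destruct k; left; reflexivity.
  - destruct k as [|k]; [simpl in Hw; lia|]. right. apply in_flat_map.
    exists w. split.
    + apply IH; [simpl in Hw; lia|]. intros x Hx; apply Hl; right; auto.
    + apply in_map_iff. exists a; split; auto. apply Hl; left; auto.
Qed.

(** Clauses are words of length at most [k] over [2 * n] literals, and [NoDup] makes the formula no
    longer than the list of all such words. So the dimension of the vectors is polynomial in [n] for
    fixed [k]. *)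
Lemma kcnf_length k n F : is_kcnf k n F -> length F <= (2 * n + 1) ^ k.
Proof.
  intros [Hnd HF].
  set (lits := list_prod (seq 0 n) [true; false]).
  assert (Hl : length lits = 2 * n).
  { unfold lits. rewrite length_prod, length_seq. simpl. lia. }
  rewrite <- Hl. etransitivity; [|apply length_words_upto].
  apply NoDup_incl_length; auto. intros cl Hcl. destruct (HF cl Hcl) as [Hk Hv].
  apply in_words_upto; auto. intros [x s] Hx. apply in_prod.
  - apply in_seq. apply Hv in Hx. simpl in Hx. lia.
  - destruct s; simpl; auto.
Qed.

Lemma encode_cnf_length k n F :
  is_kcnf k n F -> length (encode_cnf n F) <= 2 + (k + 1) * length F.
Proof.
  intros [_ HF]. unfold encode_cnf. simpl.
  assert (length (flat_map encode_clause F) <= (k + 1) * length F); [|lia].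
  induction F as [|c F IH]; simpl; [lia|].
  rewrite length_app, length_map.
  specialize (IH (fun c Hc => HF c (or_intror Hc))).
  pose proof (proj1 (HF c (or_introl eq_refl))). nia.
Qed.

Lemma pow2_pos n : 0 < 2 ^ n.
Proof. apply Nat.neq_0_lt_0, Nat.pow_nonzero; lia. Qed.

(** One polynomial above all the small quantities: it dominates [n + 1], [d + 3] and
    [(k + 1) * d + 3], the last of which bounds the input length. *)
Definition poly (k n : nat) : nat := (k + 4) * (2 * n + 1) ^ (k + 1).

Lemma mul_regroup a b c x y : a * (x * y) * (b * (c * y)) = a * (b * c) * (x * y * y).
Proof. ring. Qed.

(** Each quantity is brought to the form constant times powers of [N] and [Z]. The lower bound 1 on
    the product of the sizes is there because a power grows with its exponent only for bases of at
    least 1. *)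
Lemma reduction_bounds k n F :
  is_kcnf k n F ->
  let H := (n + 1) / 2 in
  let N := 2 ^ H in
  let d := length F in
  let L := N * (d + 3) in
  let len := length (encode_cnf n F) in
  let S := 64 * L + len in
  let V := 64 + S + len + 4 * H + 2 * N + 4 * L + d in
  let steps := 200 + 5 * n + 20 * H + 11 * len + 76 * L
                 + N * (90 + 42 * H + d * (60 + 14 * k)) in
  let Z := poly k n in
  steps * (2 * bitlen V) <= (1000 * (2 * 500)) * (N * Z * Z) /\
  1 <= (N * (d + 3)) * (10 * L + 2 + N * (4 * d + 3)) <= 200 * ((N * Z) * (N * Z)).
Proof.
  intros HF H N d L len S V steps Z.
  pose proof (kcnf_length k n F HF) as Hd. fold d in Hd.
  pose proof (encode_cnf_length k n F HF) as Hlen. fold d len in Hlen.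
  pose proof (half_bounds n) as Hn. fold H in Hn.
  assert (HN : 1 <= N) by apply pow2_pos.
  set (D := (2 * n + 1) ^ k) in *.
  assert (HD : 1 <= D) by (apply Nat.neq_0_lt_0, Nat.pow_nonzero; lia).
  assert (EZ : Z = (k + 4) * ((2 * n + 1) * D)).
  { unfold Z, poly. rewrite Nat.pow_add_r, Nat.pow_1_r. fold D. ring. }
  assert (HD' : D <= (2 * n + 1) * D)
    by (rewrite <- (Nat.mul_1_l D) at 1; apply Nat.mul_le_mono_r; lia).
  assert (Hn' : 2 * n + 1 <= (2 * n + 1) * D)
    by (rewrite <- (Nat.mul_1_r (2 * n + 1)) at 1; apply Nat.mul_le_mono_l; auto).
  assert (HkD : (k + 4) * D <= Z) by (rewrite EZ; apply Nat.mul_le_mono_l; auto).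
  assert (HnZ : n + 1 <= Z).
  { rewrite EZ. apply Nat.le_trans with (1 * ((2 * n + 1) * D)); [lia|].
    apply Nat.mul_le_mono_r; lia. }
  clearbody D Z. clear EZ HD' Hn'.
  assert (Hkd' : (k + 1) * d <= (k + 1) * D) by (apply Nat.mul_le_mono_l; auto).
  assert (Hkd : (k + 1) * d + 3 <= Z) by lia.
  assert (HdZ : d + 3 <= Z) by lia.
  assert (Hdk : d * (60 + 14 * k) <= 60 * Z) by lia.
  clear Hkd' Hd HD HkD D.
  assert (HNZ : Z <= N * Z) by
    (rewrite <- (Nat.mul_1_l Z) at 1; apply Nat.mul_le_mono_r; auto).
  assert (HL : L <= N * Z) by (apply Nat.mul_le_mono_l; auto).
  assert (HNN : N <= N * Z)
    by (rewrite <- (Nat.mul_1_r N) at 1; apply Nat.mul_le_mono_l; lia).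
  assert (Hsteps : steps <= 1000 * (N * Z)).
  { unfold steps.
    assert (N * (90 + 42 * H + d * (60 + 14 * k)) <= N * (90 + 42 * Z + 60 * Z))
      by (apply Nat.mul_le_mono_l; lia).
    lia. }
  assert (HV : V <= 400 * Z * N) by (unfold V, S; lia).
  (* The factor [N = 2 ^ H] of the bound on [V] contributes exactly [H] to the logarithm, so that
     values exponential in [n] have polynomial bit length. *)
  assert (Hbit : bitlen V <= 500 * Z).
  { unfold bitlen. apply Nat.log2_le_mono in HV. unfold N in HV.
    rewrite Nat.log2_mul_pow2 in HV by lia.
    assert (Nat.log2 (400 * Z) < 400 * Z) by (apply Nat.log2_lt_lin; lia). lia. }
  split; [|split].
  - eapply Nat.le_trans;
      [apply Nat.mul_le_mono; [exact Hsteps|apply Nat.mul_le_mono_l; exact Hbit]|].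
    apply Nat.eq_le_incl, mul_regroup.
  - assert (1 <= N * (d + 3)) by (apply (Nat.mul_le_mono 1 N 1); lia).
    apply (Nat.mul_le_mono 1 _ 1); lia.
  - assert (N * (4 * d + 3) <= N * (7 * Z)) by (apply Nat.mul_le_mono_l; lia).
    replace (200 * ((N * Z) * (N * Z))) with ((N * Z) * (200 * (N * Z)))
      by (generalize 200; intros; ring).
    apply Nat.mul_le_mono; [exact HL|]. lia.
Qed.

(** * Estimates with real exponents *)

Local Open Scope R_scope.

(** With [c = delta * ln 2] the power is [exp (c * n)], which is at least [1 + c * n]; the factor
    [1 + 2 / c] lifts this above [2 * n + 1]. *)
Lemma linear_le_pow2 delta :
  0 < delta ->
  exists C, 0 < C /\ forall n : nat, INR (2 * n + 1) <= C * Rpower 2 (delta * INR n).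
Proof.
  intros Hd. set (c := delta * ln 2).
  assert (Hc : 0 < c).
  { apply Rmult_lt_0_compat; auto. rewrite <- ln_1. apply ln_increasing; lra. }
  assert (Hc' : 0 < / c) by (apply Rinv_0_lt_compat; auto).
  exists (1 + 2 * / c). split; [lra|]. intros n.
  unfold Rpower. replace (delta * INR n * ln 2) with (c * INR n) by (unfold c; ring).
  pose proof (pos_INR n) as Hn.
  apply Rle_trans with ((1 + 2 * / c) * (1 + c * INR n)).
  - rewrite plus_INR, mult_INR. simpl (INR 2). simpl (INR 1).
    replace ((1 + 2 * / c) * (1 + c * INR n))
      with (1 + c * INR n + 2 * / c + 2 * INR n) by (field; lra).
    assert (0 <= c * INR n) by (apply Rmult_le_pos; lra). lra.
  - apply Rmult_le_compat_l; [lra|]. apply exp_ineq1_le.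
Qed.

(** The exponent [delta] is halved at each degree: one half pays for a linear factor, the other for
    the remaining power. *)
Lemma poly_le_pow2 q : forall delta, 0 < delta ->
  exists C, 0 < C /\ forall n : nat, INR ((2 * n + 1) ^ q) <= C * Rpower 2 (delta * INR n).
Proof.
  induction q as [|q IH]; intros delta Hd.
  - exists 1. split; [lra|]. intros n. simpl. rewrite Rmult_1_l.
    rewrite <- (Rpower_O 2) at 1 by lra. apply Rle_Rpower; [lra|].
    apply Rmult_le_pos; [lra|apply pos_INR].
  - destruct (linear_le_pow2 (delta / 2)) as (C1 & HC1 & H1); [lra|].
    destruct (IH (delta / 2)) as (C2 & HC2 & H2); [lra|].
    exists (C1 * C2). split; [apply Rmult_lt_0_compat; auto|]. intros n.
    rewrite Nat.pow_succ_r', mult_INR.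
    replace (C1 * C2 * Rpower 2 (delta * INR n)) with
      ((C1 * Rpower 2 (delta / 2 * INR n)) * (C2 * Rpower 2 (delta / 2 * INR n))).
    + apply Rmult_le_compat; auto using pos_INR.
    + replace (delta * INR n) with (delta / 2 * INR n + delta / 2 * INR n) by field.
      rewrite Rpower_plus. ring.
Qed.

(** Rounding [n / 2] up adds at most 1/2 to the exponent, well within the factor 2. *)
Lemma pow2_half_le n : INR (2 ^ ((n + 1) / 2)) <= 2 * Rpower 2 (INR n / 2).
Proof.
  rewrite pow_INR. simpl (INR 2). rewrite <- Rpower_pow by lra.
  replace (2 * Rpower 2 (INR n / 2)) with (Rpower 2 (INR n / 2 + 1))
    by (rewrite Rpower_plus, Rpower_1 by lra; ring).
  apply Rle_Rpower; [lra|].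
  pose proof (proj2 (half_bounds n)) as H. apply le_INR in H.
  rewrite mult_INR, plus_INR in H. simpl (INR 2) in H. simpl (INR 1) in H. lra.
Qed.

Lemma Rpower_pos x y : 0 < Rpower x y.
Proof. apply exp_pos. Qed.

(** With [alpha <= 1/2], [eps = alpha / 2] and polynomial factors at most
    [2 ^ (alpha / 4 * n)], the exponents are
    [1/2 + alpha / 2 <= 1 - eps] and [(1 + alpha / 2) * (1 - alpha) <= 1 - eps]. *)
Lemma total_time alpha K k :
  0 < alpha <= 1 / 2 -> 0 <= K ->
  exists C, forall n,
    let N := (2 ^ ((n + 1) / 2))%nat in
    let Z := poly k n in
    INR ((1000 * (2 * 500)) * (N * Z * Z))
      + K * Rpower (INR (200 * ((N * Z) * (N * Z)))) (1 - alpha)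
    <= C * Rpower 2 ((1 - alpha / 2) * INR n).
Proof.
  intros Ha HK.
  destruct (poly_le_pow2 (k + 1) (alpha / 4)) as (C0 & HC0 & HZ0); [lra|].
  set (CZ := INR (k + 4) * C0).
  assert (HCZ : 0 < CZ).
  { apply Rmult_lt_0_compat; auto. apply lt_0_INR. lia. }
  assert (HZ : forall n, INR (poly k n) <= CZ * Rpower 2 (alpha / 4 * INR n)).
  { intros n. unfold poly, CZ. rewrite mult_INR, Rmult_assoc.
    apply Rmult_le_compat_l; auto using pos_INR. }
  clearbody CZ.
  set (c1 := INR (1000 * (2 * 500))). set (c2 := INR 200).
  assert (Hc1 : 0 <= c1) by apply pos_INR.
  assert (Hc2 : 0 < c2) by (apply lt_0_INR; lia).
  set (K1 := c1 * (2 * CZ * CZ)).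
  set (K2 := K * Rpower (c2 * ((2 * CZ) * (2 * CZ))) (1 - alpha)).
  assert (HK2 : 0 <= K2)
    by (apply Rmult_le_pos; [auto | apply Rlt_le, Rpower_pos]).
  exists (K1 + K2). intros n N Z.
  rewrite !(mult_INR _ (N * Z * Z)), !(mult_INR _ (N * Z * (N * Z))), !(mult_INR (N * Z)).
  fold c1 c2. clearbody c1 c2.
  set (x := Rpower 2 (INR n / 2)). set (y := Rpower 2 (alpha / 4 * INR n)).
  assert (HN : INR N <= 2 * x) by apply pow2_half_le.
  assert (HZn : INR Z <= CZ * y) by apply HZ.
  assert (HNZ : INR (N * Z) <= (2 * CZ) * (x * y)).
  { rewrite mult_INR.
    replace (2 * CZ * (x * y)) with ((2 * x) * (CZ * y)) by ring.
    apply Rmult_le_compat; auto using pos_INR. }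
  assert (Hx : 0 < x) by apply Rpower_pos.
  assert (Hy : 0 < y) by apply Rpower_pos.
  pose proof (pos_INR n) as Hn.
  rewrite Rmult_plus_distr_r. apply Rplus_le_compat.
  - apply Rle_trans with (K1 * (x * y * y)).
    + unfold K1. replace (c1 * (2 * CZ * CZ) * (x * y * y))
        with (c1 * ((2 * CZ * (x * y)) * (CZ * y))) by ring.
      apply Rmult_le_compat_l; auto. apply Rmult_le_compat; auto using pos_INR.
    + apply Rmult_le_compat_l.
      { unfold K1. repeat apply Rmult_le_pos; lra. }
      unfold x, y. rewrite <- !Rpower_plus. apply Rle_Rpower; [lra|].
      replace (INR n / 2 + alpha / 4 * INR n + alpha / 4 * INR n)
        with ((1 / 2 + alpha / 2) * INR n) by field.
      apply Rmult_le_compat_r; lra.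
  - unfold K2. rewrite Rmult_assoc. apply Rmult_le_compat_l; auto.
    apply Rle_trans with
      (Rpower (c2 * (2 * CZ * (2 * CZ)) * (x * y * (x * y))) (1 - alpha)).
    + assert (0 < INR (N * Z)).
      { apply lt_0_INR. apply (Nat.mul_lt_mono 0 N 0).
        - apply pow2_pos.
        - unfold Z, poly. apply (Nat.mul_lt_mono 0 _ 0); [lia|].
          apply Nat.neq_0_lt_0, Nat.pow_nonzero; lia. }
      apply Rle_Rpower_l; [lra|]. split.
      * repeat apply Rmult_lt_0_compat; auto.
      * replace (c2 * (2 * CZ * (2 * CZ)) * (x * y * (x * y)))
          with (c2 * ((2 * CZ * (x * y)) * (2 * CZ * (x * y)))) by ring.
        apply Rmult_le_compat_l; [lra|]. apply Rmult_le_compat; auto using pos_INR.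
    + rewrite <- Rpower_mult_distr by (repeat apply Rmult_lt_0_compat; lra).
      apply Rmult_le_compat_l; [apply Rlt_le, Rpower_pos|].
      unfold x, y. rewrite <- !Rpower_plus, Rpower_mult. apply Rle_Rpower; [lra|].
      replace ((INR n / 2 + alpha / 4 * INR n + (INR n / 2 + alpha / 4 * INR n))
                 * (1 - alpha)) with ((1 + alpha / 2) * (1 - alpha) * INR n) by field.
      apply Rmult_le_compat_r; nra.
Qed.

(** * From the intersection test to k-SAT *)

Lemma decides_within_mono P l answer answer' b b' :
  decides_within P l answer b -> (answer <-> answer') -> b <= b' ->
  decides_within P l answer' b'.
Proof.
  intros (t & c & Hrun & Hans & Ht) Hiff Hb. exists t, c. repeat split; auto.
  - intros H. apply Hiff, Hans, H.
  - intros H. apply Hans, Hiff, H.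
  - lra.
Qed.

Theorem theorem1 :
  SETH ->
  forall alpha : R, (0 < alpha)%R ->
    ~ exists (P : program) (K : R),
        decides_intersection OpConc OpPlus OpConc OpAlt P
          (fun m n : nat => (K * Rpower (INR (m * n)) (1 - alpha))%R).
Proof.
  intros Hseth alpha0 Ha0 (P & K & HP).
  (* A smaller [alpha] only weakens the assumed time bound. The cap 1/2 keeps the exponent
     [1 - alpha] positive and leaves time for writing the expressions, which takes about
     [2 ^ (n / 2)]. *)
  set (alpha := Rmin alpha0 (1 / 2)).
  assert (Ha : 0 < alpha <= 1 / 2).
  { unfold alpha. split; [apply Rmin_glb_lt; lra | apply Rmin_r]. }
  destruct (Hseth (alpha / 2)) as (k & Hk); [lra|]. apply Hk. clear Hk Hseth.
  (* The constant [K] is an arbitrary real; [Rabs K] is a nonnegative one above it. *)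
  destruct (total_time alpha (Rabs K) k Ha (Rabs_pos K)) as (C & HC).
  exists (reduce_to P), C. intros n F HF. specialize (HC n). cbv zeta in HC.
  destruct (reduction_bounds k n F HF) as (Hsteps & Hsize1 & Hsize2).
  cbv zeta in *.
  set (H := ((n + 1) / 2)%nat) in *.
  set (L := (2 ^ H * (length F + 3))%nat) in *.
  assert (HL : (3 <= L)%nat).
  { pose proof (pow2_pos H). apply (Nat.mul_le_mono 1 _ 3); lia. }
  pose proof (size_regA (length F) (vectors H 0 F) (vectors_binary _ _ _)) as HsA.
  pose proof (size_regB (length F) L (vectors H H F) (vectors_binary _ _ _)) as HsB.
  rewrite length_vectors in HsA, HsB. fold L in HsA.
  assert (Hdec := HP (regA (vectors H 0 F)) (regB L (vectors H H F))).
  rewrite HsA, HsB in Hdec.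
  assert (Hbinary : forall lo, Forall binary (vectors H lo F)).
  { intros lo. eapply Forall_impl; [|apply vectors_binary]. intros u [_ Hu]; exact Hu. }
  assert (Hne : vectors H 0 F <> []).
  { intros E. pose proof (length_vectors H 0 F) as E'. rewrite E in E'.
    pose proof (pow2_pos H). simpl in E'. lia. }
  (* The five letters 0 to 4 must be numbered below the sum of the sizes. *)
  assert (H4 : (4 < L + (10 * L + 2 + 2 ^ H * (4 * length F + 3)))%nat) by lia.
  specialize (Hdec (homogeneous_regA _ Hne)
    (homogeneous_regB L _ (Nat.lt_le_trans 0 3 L ltac:(lia) HL))
    (over_alphabet_regA _ _ H4 (Hbinary 0%nat)) (over_alphabet_regB _ _ _ H4)).
  apply (reduce_to_correct P k) in Hdec; auto.
  eapply decides_within_mono; [exact Hdec | apply (reduction_correct k); auto |].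
  eapply Rle_trans; [|exact HC].
  apply Rplus_le_compat; [apply le_INR; exact Hsteps|].
  set (m := (L * (10 * L + 2 + 2 ^ H * (4 * length F + 3)))%nat) in *.
  apply le_INR in Hsize1, Hsize2. simpl (INR 1) in Hsize1.
  apply Rle_trans with (Rabs K * Rpower (INR m) (1 - alpha0)).
  - apply Rmult_le_compat_r; [apply Rlt_le, Rpower_pos | apply Rle_abs].
  - apply Rmult_le_compat_l; [apply Rabs_pos|].
    apply Rle_trans with (Rpower (INR m) (1 - alpha)).
    (* The product of the sizes is at least 1, so the larger exponent [1 - alpha] gives the larger
       bound. *)
    + apply Rle_Rpower; auto. pose proof (Rmin_l alpha0 (1 / 2)) as Hmin.
      fold alpha in Hmin. lra.
    + apply Rle_Rpower_l; [lra|]. split; [lra|exact Hsize2].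
Qed.
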